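(* Let $M$ be a Riemannian manifold, let $\mu$ be a Borel probability measure on $M$ and $\nu$ a positive Borel measure on $M$. Let $q\in[1/2,1)$. If $(\mu,\nu)$ satisfies the $L^q$-Poincaré inequality (for some constant), then $(\mu,\nu)$ also satisfies a weak Poincaré inequality with function $$\beta_{WP}(s)=\kappa\,\beta_P\,s^{1-1/q},\qquad \kappa:=\frac{11+5\sqrt5}{2},$$ that is, for any bounded $f\in C^1(M)$ and all $s>0$, $$\mathrm{Var}_\mu(f)\le\kappa\,\beta_P\,s^{1-1/q}\int|\nabla f|^2d\nu+s\,\big[\mathrm{Osc}_\mu(f)\big]^2.$$
   Context: $(\mu,\nu)$ satisfies an $L^q$-Poincaré inequality with constant $C_P$ if for all non-negative $f\in C^1(M)$: $[\mathrm{Var}_\mu(f^q)]^{1/q}=[\int f^{2q}d\mu-(\int f^qd\mu)^2]^{1/q}\le C_P\int|\nabla f|^2d\nu$. $\mathrm{Osc}_\mu(f):=\operatorname{ess\,sup}_\mu f-\operatorname{ess\,inf}_\mu f$. $(\mu,\nu)$ satisfies a weak Poincaré inequality with function $\beta_{WP}$ (non-negative, non-increasing on $(0,\infty)$) if for all bounded $f\in C^1(M)$ and all $s>0$: $\mathrm{Var}_\mu(f)\le\beta_{WP}(s)\int|\nabla f|^2d\nu+s[\mathrm{Osc}_\mu(f)]^2$. For measurable $A\subset\Omega\subset M$, $\mathrm{Cap}_\nu(A,\Omega):=\inf\{\int|\nabla f|^2d\nu: f\in C^1(M),\ \mathbb 1_A\le f\le\mathbb 1_\Omega\}$ ($+\infty$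 if there is no such $f$). The constant $\beta_P$ is $$\beta_P:=\sup\Big\{\sum_{k\in\mathbb Z}\frac{[\mu(\Omega_k)]^{1/(1-q)}}{[\mathrm{Cap}_\nu(\Omega_k,\Omega_{k+1})]^{q/(1-q)}}\Big\}^{(1-q)/q},$$ the supremum being over all measurable $\Omega\subset M$ with $\mu(\Omega)\le1/2$ and all sequences of measurable sets with $\Omega_k\subset\Omega_{k+1}\subset\Omega$ for all $k\in\mathbb Z$. (Terms with infinite capacity are $0$, terms with $\mu(\Omega_k)>0$ and zero capacity are $+\infty$, and $0/0$ is read as $0$.) *)

(* Defs.v *)
From mathcomp Require Import all_boot all_order all_algebra.
From mathcomp Require Import all_classical all_reals all_analysis.
From mathcomp Require Import ess_sup_inf.
Set Implicit Arguments.
Unset Strict Implicit.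
Unset Printing Implicit Defensive.
Import Order.TTheory GRing.Theory Num.Theory.
Import numFieldNormedType.Exports.
Local Open Scope classical_set_scope.
Local Open Scope ring_scope.

Definition partial_deriv (R : realType) (n : nat) (i : 'I_n)
    (f : 'rV[R]_n -> R) : 'rV[R]_n -> R :=
  'D_(delta_mx 0 i) f.

(* Class C^k on D; meaningful when D is open. *)
Fixpoint Ck_on (R : realType) (n k : nat) (D : set 'rV[R]_n)
    (f : 'rV[R]_n -> R) : Prop :=
  match k with
  | 0 => forall y, D y -> {for y, continuous f}
  | k'.+1 => (forall y, D y -> differentiable f y) /\
             (forall i, Ck_on k' D (partial_deriv i f))
  end.

Definition smooth_on (R : realType) (n : nat) (D : set 'rV[R]_n)
    (f : 'rV[R]_n -> R) : Prop :=
  forall k, Ck_on k D f.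

(* [chart_map] and [chart_inv] are total functions; their values outside
   [chart_dom] and [chart_cod] are irrelevant. *)
Record chart (R : realType) (n : nat) (M : topologicalType) := Chart {
  chart_dom : set M;
  chart_cod : set 'rV[R]_n;
  chart_map : M -> 'rV[R]_n;
  chart_inv : 'rV[R]_n -> M;
  chart_dom_open : open chart_dom;
  chart_cod_open : open chart_cod;
  chart_map_cod : forall x, chart_dom x -> chart_cod (chart_map x);
  chart_inv_dom : forall y, chart_cod y -> chart_dom (chart_inv y);
  chart_mapK : forall x, chart_dom x -> chart_inv (chart_map x) = x;
  chart_invK : forall y, chart_cod y -> chart_map (chart_inv y) = y;
  chart_map_continuous : {within chart_dom, continuous chart_map};
  chart_inv_continuous : {within chart_cod, continuous chart_inv}
}.

Definition transition (R : realType) (n : nat) (M : topologicalType)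
    (c c' : chart R n M) : 'rV[R]_n -> 'rV[R]_n :=
  chart_map c' \o chart_inv c.

Definition transition_dom (R : realType) (n : nat) (M : topologicalType)
    (c c' : chart R n M) : set 'rV[R]_n :=
  [set y | chart_cod c y /\ chart_dom c' (chart_inv c y)].

Record smooth_manifold (R : realType) (n : nat) (M : topologicalType) :=
SmoothManifold {
  manifold_hausdorff : hausdorff_space M;
  manifold_second_countable : @second_countable M;
  atlas : set (chart R n M);
  chart_at : M -> chart R n M;
  chart_at_atlas : forall x, atlas (chart_at x);
  chart_at_dom : forall x, chart_dom (chart_at x) x;
  transition_smooth : forall c c', atlas c -> atlas c' ->
    forall i : 'I_n,
      smooth_on (transition_dom c c') (fun y => transition c c' y 0 i)
}.

(* [gram c x] is the matrix (g_ij(x)) of the metric in the coordinates of [c].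
   Tangent vectors are row vectors, and ['J f y] acts on them by right
   multiplication, whence the form of the transformation law. *)
Record riemannian_manifold (R : realType) (n : nat) (M : topologicalType) :=
RiemannianManifold {
  manifold_of :> smooth_manifold R n M;
  gram : chart R n M -> M -> 'M[R]_n;
  gram_sym : forall c x, atlas manifold_of c -> chart_dom c x ->
    (gram c x)^T = gram c x;
  gram_posdef : forall c x, atlas manifold_of c -> chart_dom c x ->
    forall v : 'rV[R]_n, v != 0 -> 0 < (v *m gram c x *m v^T) 0 0;
  gram_smooth : forall c, atlas manifold_of c -> forall i j : 'I_n,
    smooth_on (chart_cod c) (fun y => gram c (chart_inv c y) i j);
  gram_transition : forall c c' x,
    atlas manifold_of c -> atlas manifold_of c' ->
    chart_dom c x -> chart_dom c' x ->
    gram c x = 'J (transition c c') (chart_map c x) *m gram c' x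
               *m ('J (transition c c') (chart_map c x))^T
}.

Definition C1 (R : realType) (n : nat) (M : topologicalType)
    (X : riemannian_manifold R n M) (f : M -> R) : Prop :=
  forall c, atlas X c -> Ck_on 1 (chart_cod c) (f \o chart_inv c).

Definition local_differential (R : realType) (n : nat) (M : topologicalType)
    (c : chart R n M) (f : M -> R) (x : M) : 'rV[R]_n :=
  \row_i partial_deriv i (f \o chart_inv c) (chart_map c x).

(* Coordinates of the gradient in the chart [chart_at X x]: the vector v such
   that g(v, w) = df(w) for all w. *)
Definition grad (R : realType) (n : nat) (M : topologicalType)
    (X : riemannian_manifold R n M) (f : M -> R) (x : M) : 'rV[R]_n :=
  local_differential (chart_at X x) f x *m invmx (gram X (chart_at X x) x).

Definition sqnorm_grad (R : realType) (n : nat) (M : topologicalType)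
    (X : riemannian_manifold R n M) (f : M -> R) (x : M) : R :=
  (grad X f x *m gram X (chart_at X x) x *m (grad X f x)^T) 0 0.

(* [M] with its Borel sigma-algebra *)
Notation borel M := (g_sigma_algebraType (@open M)).

Local Open Scope ereal_scope.

Definition energy (R : realType) (n : nat) (M : ptopologicalType)
    (X : riemannian_manifold R n M) (nu : {measure set (borel M) -> \bar R})
    (f : M -> R) : \bar R :=
  \int[nu]_(x in [set: borel M]) (sqnorm_grad X f x)%:E.

(* The product c * E, read as +oo when E = +oo (even if c = 0): an upper bound
   by a multiple of an infinite energy is void, whereas 0 * +oo = 0 in the
   library. *)
Definition mul_energy (R : realType) (c E : \bar R) : \bar R :=
  if E == +oo then +oo else c * E.

(* ['V_mu[g]] is the integral of (g - E g)^2; it is +oo when g is nonnegative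
   and not square integrable. *)
Definition Lq_poincare (R : realType) (n : nat) (M : ptopologicalType)
    (X : riemannian_manifold R n M) (mu : probability (borel M) R)
    (nu : {measure set (borel M) -> \bar R}) (q C : R) : Prop :=
  forall f : M -> R, C1 X f -> (forall x, (0 <= f x)%R) ->
    variance mu (fun x : borel M => f x `^ q)%R `^ q^-1
      <= mul_energy C%:E (energy X nu f).

Definition osc (R : realType) (M : ptopologicalType)
    (mu : probability (borel M) R) (f : M -> R) : \bar R :=
  ess_sup mu (fun x : borel M => (f x)%:E)
  - ess_inf mu (fun x : borel M => (f x)%:E).

Definition weak_poincare (R : realType) (n : nat) (M : ptopologicalType)
    (X : riemannian_manifold R n M) (mu : probability (borel M) R)
    (nu : {measure set (borel M) -> \bar R}) (beta : R -> \bar R) : Prop :=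
  [/\ forall s, (0 < s)%R -> 0 <= beta s < +oo,
      forall s t, (0 < s)%R -> (s <= t)%R -> beta t <= beta s &
      forall f : M -> R, C1 X f -> bounded_fun f -> forall s, (0 < s)%R ->
        variance mu (f : borel M -> R)
          <= mul_energy (beta s) (energy X nu f) + s%:E * (osc mu f) ^+ 2].

Definition capacity (R : realType) (n : nat) (M : ptopologicalType)
    (X : riemannian_manifold R n M) (nu : {measure set (borel M) -> \bar R})
    (A Om : set (borel M)) : \bar R :=
  ereal_inf [set energy X nu f | f in
    [set f : M -> R | C1 X f /\ forall x, (\1_A x <= f x <= \1_Om x)%R]].

(* In \bar R, (+oo)^-1 = 0, 0^-1 = +oo and 0 * +oo = 0; hence an infinite
   capacity gives 0, a zero capacity gives +oo if mu (Om k) > 0, and 0 / 0 is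
   read as 0. *)
Definition beta_P (R : realType) (n : nat) (M : ptopologicalType)
    (X : riemannian_manifold R n M) (mu : probability (borel M) R)
    (nu : {measure set (borel M) -> \bar R}) (q : R) : \bar R :=
  (ereal_sup [set S | exists (Om : set (borel M)) (Omk : int -> set (borel M)),
     [/\ measurable Om, mu Om <= (2^-1)%:E,
         forall k, measurable (Omk k),
         forall k, Omk k `<=` Omk (k + 1)%R /\ Omk (k + 1)%R `<=` Om &
         S = \esum_(k in [set: int])
               (mu (Omk k) `^ (1 - q)^-1
                / capacity X nu (Omk k) (Omk (k + 1)%R) `^ (q / (1 - q)))]])
  `^ ((1 - q) / q).

Definition kappa (R : realType) : R := ((11 + 5 * Num.sqrt 5) / 2)%R.

(* Main.v *)
(** A bounded C^1 function f is cut at a median m into its parts above and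
    below m, and each part u is cut at the levels t_k = L rho^-k. Clipping u
    between two consecutive levels bounds the capacity of {u >= t_k} in
    {u >= t_(k+1)} by the energy of f between them, so that a level sum for the
    integral of u_+^2 is controlled by the terms of beta_P and the energy, by
    Young's inequality applied term by term. The constant
    rho^2 (rho^2 - 1) / (rho - 1)^2 that comes out is minimal at the golden
    ratio, where it equals kappa = rho^5; the coefficient of the oscillation is
    rho (1 - q) <= 1 since q >= 1/2.

    Finiteness of beta_P: if f_k nearly realizes the k-th capacity c_k and
    d_k^2 c_k = a_k is the k-th term of beta_P, then the gradients of the f_k
    have disjoint supports (a gradient vanishes at the extrema 0 and 1 of f_k),
    so F = sum_k d_k f_k has energy about S = sum_k a_k, while
    F^(2q) >= sum_k d_k^(2q) 1_(Omega_k) because 2q >= 1. The L^q-Poincare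
    inequality for F becomes (S/3)^(1/q) <= C S, which bounds S.

    The squared gradient norm is not shown to be measurable: MathComp-Analysis
    integrates a non-negative function as the supremum over the simple functions
    below it, and the few properties of this lower integral that are needed
    (monotonicity, scaling, additivity over measurable sets) hold for all
    non-negative functions. *)

Require Import Defs.
From mathcomp Require Import all_boot all_order all_algebra finmap.
From mathcomp Require Import all_classical all_reals all_analysis.
From mathcomp Require Import measurable_realfun ess_sup_inf.
From mathcomp Require Import ring lra.
Set Implicit Arguments.
Unset Strict Implicit.
Unset Printing Implicit Defensive.
Import Order.TTheory GRing.Theory Num.Theory.
Import numFieldNormedType.Exports.
Local Open Scope classical_set_scope.
Local Open Scope ring_scope.

(** * Integrals of non-negative, possibly non-measurable functions *)

(** If [z] is finite, so are all elements of [X] and [Y], because their sums are at most [z] and all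
    terms are non-negative. Subtraction is then legitimate, and the two suprema can be taken one
    after the other. This yields the superadditive half of [integral_setU_ge0]. *)
Lemma ereal_supD_le (R : realType) (X Y : set (\bar R)) (z : \bar R) :
  (forall x, X x -> 0 <= x)%E -> (forall y, Y y -> 0 <= y)%E ->
  (forall x y, X x -> Y y -> x + y <= z)%E ->
  X !=set0 -> Y !=set0 ->
  (ereal_sup X + ereal_sup Y <= z)%E.
Proof.
move=> X0 Y0 XYz [x0 Xx0] [y0 Yy0].
have [->|zoo] := eqVneq z +oo%E; first by rewrite leey.
have zfin : z \is a fin_num.
  rewrite ge0_fin_numE ?ltey//; apply: le_trans (XYz _ _ Xx0 Yy0).
  by apply: adde_ge0; [exact: X0|exact: Y0].
have Yfin y : Y y -> y \is a fin_num.
  move=> Yy; rewrite ge0_fin_numE ?Y0//; apply: (@le_lt_trans _ _ z); last by rewrite ltey.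
  by apply: le_trans (XYz _ _ Xx0 Yy); rewrite leeDr// X0.
have Xz y : Y y -> (ereal_sup X <= z - y)%E.
  by move=> Yy; apply: ge_ereal_sup => x Xx; rewrite leeBrDr ?Yfin// XYz.
have sXfin : ereal_sup X \is a fin_num.
  rewrite ge0_fin_numE; last by apply: le_trans (X0 _ Xx0) _; exact: ereal_sup_ubound.
  by apply: (le_lt_trans (Xz _ Yy0)); rewrite ltey_eq fin_numB zfin Yfin.
rewrite addeC -leeBrDr//; apply: ge_ereal_sup => y Yy.
by rewrite leeBrDr// addeC -leeBrDr ?Yfin// Xz.
Qed.

Section LowerIntegral.
Context d (T : measurableType d) (R : realType).
Variable mu : {measure set T -> \bar R}.
Local Open Scope ereal_scope.
Implicit Types f g : T -> \bar R.

Import HBNNSimple.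

Lemma le_integral_ge0 f g : (forall x, 0 <= f x) -> (forall x, f x <= g x) ->
  \int[mu]_x f x <= \int[mu]_x g x.
Proof.
move=> f0 fg; have g0 x : 0 <= g x by exact: le_trans (fg x).
rewrite !ge0_integralTE//; apply: ereal_sup_le => _ [h hf <-].
by exists h => // x; exact: le_trans (fg x).
Qed.

(** For [k > 0], a simple function below [k * f] becomes one below [f] after division by [k]. *)
Lemma integralZ_ge0_le f (k : R) : (forall x, 0 <= f x) -> (0 <= k)%R ->
  \int[mu]_x (k%:E * f x) <= k%:E * \int[mu]_x f x.
Proof.
move=> f0; rewrite le_eqVlt => /predU1P[<-|k0].
  by under eq_integral do rewrite mul0e; rewrite integral0 mul0e.
have kf0 x : 0 <= k%:E * f x by rewrite mule_ge0// lee_fin ltW.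
rewrite !ge0_integralTE//; apply: ge_ereal_sup => _ [h hf <-].
have ki0 : (0 <= k^-1)%R by rewrite invr_ge0 ltW.
pose h' := scale_nnsfun h ki0.
have -> : sintegral mu h = k%:E * sintegral mu h'.
  rewrite -sintegralrM; apply: eq_sintegral => x /=.
  by rewrite mulVKf ?gt_eqF.
rewrite lee_pmul2l//; apply: ereal_sup_ubound; exists h' => // x /=.
by rewrite EFinM lee_pdivrMl.
Qed.

(** Only [A] and [B] have to be measurable. A simple function below [f] on the union splits into its
    products with the indicators of [A] and [B], which are again simple. Conversely, simple
    functions below the two restrictions add up to one below the restriction to the union. *)
Lemma integral_setU_ge0 f (A B : set T) : measurable A -> measurable B ->
  [disjoint A & B] -> (forall x, 0 <= f x) ->
  \int[mu]_(x in A `|` B) f x = \int[mu]_(x in A) f x + \int[mu]_(x in B) f x.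
Proof.
move=> mA mB /disj_setPS AB f0; rewrite !ge0_integralE//.
apply/eqP; rewrite eq_le; apply/andP; split.
- apply: ge_ereal_sup => _ [h /= hf <-].
  have -> : sintegral mu h =
      sintegral mu (proj_nnsfun h mA) + sintegral mu (proj_nnsfun h mB).
    rewrite -sintegralD; apply: eq_sintegral => x /=.
    have := hf x; rewrite !mindicE patchE in_setU.
    have [xA|xA] := boolP (x \in A); have [xB|xB] := boolP (x \in B) => /=.
    + by have /AB : (A `&` B) x by split; exact/set_mem.
    + by rewrite mulr1 mulr0 addr0.
    + by rewrite mulr1 mulr0 add0r.
    + rewrite lee_fin !mulr0 addr0 => hx; apply/eqP; rewrite eq_le hx/=.
      exact: fun_ge0.
  apply: leeD; apply: ereal_sup_ubound; [exists (proj_nnsfun h mA) => // x|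
    exists (proj_nnsfun h mB) => // x] => /=; rewrite mindicE patchE.
  + have := hf x; rewrite patchE in_setU; case: (x \in A) => /=.
      by rewrite mulr1.
    by rewrite mulr0.
  + have := hf x; rewrite patchE in_setU orbC; case: (x \in B) => /=.
      by rewrite mulr1.
    by rewrite mulr0.
- apply: ereal_supD_le => [_ [h _ <-]|_ [h _ <-]|||].
  4,5: by eexists; exists nnsfun0 => // x; exact: erestrict_ge0.
  + exact: sintegral_ge0.
  + exact: sintegral_ge0.
  move=> _ _ [h1 /= h1f <-] [h2 /= h2f <-].
  rewrite -sintegralD; apply: ereal_sup_ubound.
  exists (add_nnsfun h1 h2) => // x /=; rewrite EFinD.
  apply: (le_trans (leeD (h1f x) (h2f x))); rewrite !patchE in_setU.
  have [xA|xA] := boolP (x \in A); have [xB|xB] := boolP (x \in B) => /=.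
  + by have /AB : (A `&` B) x by split; exact/set_mem.
  + by rewrite adde0.
  + by rewrite add0e.
  + by rewrite adde0.
Qed.

Lemma integral_setT_ge0 f (A : set T) : measurable A -> (forall x, 0 <= f x) ->
  \int[mu]_(x in A) f x <= \int[mu]_x f x.
Proof.
move=> mA f0; rewrite -(setUv A) integral_setU_ge0//; last 2 first.
- exact: measurableC.
- by apply/disj_setPS; rewrite setICr.
by rewrite leeDl// integral_ge0.
Qed.

Lemma integral_bigsetU_ge0 (I : eqType) (F : I -> set T) f (s : seq I) :
  (forall i, measurable (F i)) -> uniq s -> trivIset [set` s] F ->
  (forall x, 0 <= f x) ->
  \int[mu]_(x in \big[setU/set0]_(i <- s) F i) f x =
  \sum_(i <- s) \int[mu]_(x in F i) f x.
Proof.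
move=> mF us tF f0; elim: s us tF => [_ _|i s ih /= /andP[si us] tF].
  by rewrite !big_nil integral_set0.
rewrite !big_cons integral_setU_ge0//; last 2 first.
- exact: bigsetU_measurable.
- apply/eqP; rewrite big_distrr/= big_seq big1// => j js.
  move/trivIsetP : tF; apply => /=; rewrite ?mem_head//.
  + by rewrite inE js orbT.
  + by apply: contraNneq si => ->.
by rewrite ih//; apply: sub_trivIset tF => j /= js; rewrite inE js orbT.
Qed.


End LowerIntegral.

(** * Gradients of C^1 functions *)

Section PartialDerivatives.
Context (R : realType) (n : nat).
Implicit Types (F G : 'rV[R]_n -> R) (h : R -> R) (y : 'rV[R]_n) (i : 'I_n).

Lemma partial_deriv_comp h F y i : differentiable F y -> derivable h (F y) 1 ->
  partial_deriv i (h \o F) y = derive1 h (F y) * partial_deriv i F y.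
Proof.
move=> dF /derivable1_diffP dh; rewrite /partial_deriv deriveE; last first.
  exact: differentiable_comp.
by rewrite diff_comp//= deriveE// diff1E//= mulrC.
Qed.

Lemma partial_derivD F G y i : differentiable F y -> differentiable G y ->
  partial_deriv i (F \+ G) y = partial_deriv i F y + partial_deriv i G y.
Proof.
by move=> dF dG; rewrite /partial_deriv deriveD//; exact: diff_derivable.
Qed.

Lemma partial_deriv_cst (c : R) y i : partial_deriv i (cst c) y = 0.
Proof. by rewrite /partial_deriv derive_cst. Qed.

(** At a maximum the difference quotients with positive step are non-positive, and the derivative is
    also their limit from the right. *)
Lemma derive_le0_max F y v : (forall z, F z <= F y) -> differentiable F y ->
  'D_v F y <= 0.
Proof.
move=> Fmax /(@diff_derivable _ _ _ _ _ v) dF.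
have H : h^-1 *: ((F \o shift y) (h *: v) - F y) @[h --> 0^'+] --> 'D_v F y.
  apply: cvg_trans dF; apply: cvg_app.
  by move=> A [e e0 Ae]; exists e => // x xe x0; apply: Ae => //; exact: lt0r_neq0.
rewrite -(cvg_lim _ H)//; apply: limr_le; first by apply/cvg_ex; eexists; exact: H.
near=> h; rewrite /GRing.scale/= mulr_ge0_le0 ?subr_le0// invr_ge0.
by near: h; exists 1 => //= ? _ /ltW.
Unshelve. all: by end_near. Qed.

(** Linearity of the differential turns the bound in direction [- v] into the opposite
    inequality. *)
Lemma derive_eq0_max F y v : (forall z, F z <= F y) -> differentiable F y ->
  'D_v F y = 0.
Proof.
move=> Fmax dF; apply/eqP; rewrite eq_le derive_le0_max//=.
have := derive_le0_max (- v) Fmax dF.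
by rewrite deriveE// linearN/= -deriveE// oppr_le0.
Qed.

Lemma derive_eq0_min F y v : (forall z, F y <= F z) -> differentiable F y ->
  'D_v F y = 0.
Proof.
move=> Fmin dF; apply/eqP; rewrite -oppr_eq0 -deriveN; last exact: diff_derivable.
by apply/eqP/derive_eq0_max => [z|]; [rewrite lerN2|exact: differentiableN].
Qed.

End PartialDerivatives.

(** The formulas for partial derivatives of functions read in a chart hold only on the open set
    [chart_cod], hence only near the point considered; this transfers continuity through such a
    local identity. *)
Lemma near_eq_continuous (T U : topologicalType) (f g : T -> U) (x : T) :
  (\near x, f x = g x) -> {for x, continuous g} -> {for x, continuous f}.
Proof.
move=> fg cg; rewrite /prop_for /continuous_at (nbhs_singleton fg).
by apply: cvg_trans cg; apply: near_eq_cvg; apply: filterS fg => z ->.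
Qed.

(** * Gradients and C^1 functions on the manifold *)

Section Manifold.
Context (R : realType) (n : nat) (M : ptopologicalType).
Variable X : riemannian_manifold R n M.
Implicit Types (f g : M -> R) (h : R -> R).

Lemma sqnorm_grad_ge0 f x : 0 <= sqnorm_grad X f x.
Proof.
rewrite /sqnorm_grad; have [->|v0] := eqVneq (grad X f x) 0.
  by rewrite !mul0mx mxE.
by apply/ltW/gram_posdef => //; [exact: chart_at_atlas|exact: chart_at_dom].
Qed.

Lemma sqnorm_grad_eq0 f x : grad X f x = 0 -> sqnorm_grad X f x = 0.
Proof. by rewrite /sqnorm_grad => ->; rewrite !mul0mx mxE. Qed.

Lemma eq_sqnorm_grad f g x : grad X f x = grad X g x ->
  sqnorm_grad X f x = sqnorm_grad X g x.
Proof. by rewrite /sqnorm_grad => ->. Qed.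

Lemma sqnorm_gradZ f g x (k : R) : grad X f x = k *: grad X g x ->
  sqnorm_grad X f x = k ^+ 2 * sqnorm_grad X g x.
Proof.
rewrite /sqnorm_grad => ->.
by rewrite linearZ/= -scalemxAl -scalemxAl -scalemxAr !mxE mulrA expr2.
Qed.

Lemma C1_differentiable f x : C1 X f ->
  differentiable (f \o chart_inv (chart_at X x)) (chart_map (chart_at X x) x).
Proof.
move=> /(_ _ (chart_at_atlas X x)) [+ _]; apply.
by apply: chart_map_cod; exact: chart_at_dom.
Qed.

(** All values of [f \o chart_inv c] are values of [f], even outside [chart_cod c], so a global
    extremum on [M] remains a global extremum on the whole coordinate space. *)
Lemma grad_eq0 f x : C1 X f ->
  (forall z, f z <= f x) \/ (forall z, f x <= f z) -> grad X f x = 0.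
Proof.
move=> Cf fx; rewrite /grad (_ : local_differential _ _ _ = 0) ?mul0mx//.
apply/rowP => i; rewrite !mxE /partial_deriv.
have e : f x = (f \o chart_inv (chart_at X x)) (chart_map (chart_at X x) x).
  by rewrite /= chart_mapK//; exact: chart_at_dom.
case: fx => fx; [apply: derive_eq0_max|apply: derive_eq0_min];
  by [move=> z; rewrite -e; exact: fx|exact: C1_differentiable].
Qed.

Lemma gradD f g x : C1 X f -> C1 X g ->
  grad X (f \+ g) x = grad X f x + grad X g x.
Proof.
move=> Cf Cg; rewrite /grad -mulmxDl; congr (_ *m _).
by apply/rowP => i; rewrite !mxE partial_derivD//; exact: C1_differentiable.
Qed.

Lemma grad_cst (c : R) x : grad X (cst c) x = 0.
Proof.
rewrite /grad (_ : local_differential _ _ _ = 0) ?mul0mx//.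
by apply/rowP => i; rewrite !mxE -[_ \o _]/(cst c) partial_deriv_cst.
Qed.

Lemma grad_comp h f x : (forall t, derivable h t 1) -> C1 X f ->
  grad X (h \o f) x = derive1 h (f x) *: grad X f x.
Proof.
move=> dh Cf; rewrite /grad scalemxAl; congr (_ *m _).
apply/rowP => i; rewrite !mxE -compA partial_deriv_comp//=.
  by rewrite chart_mapK//; exact: chart_at_dom.
exact: C1_differentiable.
Qed.

Lemma C1_comp h f : (forall t, derivable h t 1) -> continuous (derive1 h) ->
  C1 X f -> C1 X (h \o f).
Proof.
move=> dh ch Cf c cX; have [df pf] := Cf c cX.
split=> [y cy|i y cy] /=.
  by rewrite -compA; apply: differentiable_comp; [exact: df|exact/derivable1_diffP].
pose F := f \o chart_inv c.
apply: (@near_eq_continuous _ _ _ (fun z => derive1 h (F z) * partial_deriv i F z)).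
  have := open_nbhs_nbhs (conj (@chart_cod_open _ _ _ c) cy).
  by apply: filterS => z cz; rewrite -compA partial_deriv_comp//; exact: df.
apply: continuousM; last exact: pf.
apply: (@continuous_comp _ _ _ F (derive1 h)); last exact: ch.
by apply: differentiable_continuous; exact: df.
Qed.

Lemma C1D f g : C1 X f -> C1 X g -> C1 X (f \+ g).
Proof.
move=> Cf Cg c cX; have [df pf] := Cf c cX; have [dg pg] := Cg c cX.
split=> [y cy|i y cy] /=.
  suff : differentiable ((f \o chart_inv c) \+ (g \o chart_inv c)) y by [].
  by apply: differentiableD; [exact: df|exact: dg].
apply: (@near_eq_continuous _ _ _ (fun z => partial_deriv i (f \o chart_inv c) z
    + partial_deriv i (g \o chart_inv c) z)).
  have := open_nbhs_nbhs (conj (@chart_cod_open _ _ _ c) cy).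
  by apply: filterS => z cz; rewrite -partial_derivD//; [exact: df|exact: dg].
by apply: continuousD; [exact: pf|exact: pg].
Qed.

Lemma C1_cst (c : R) : C1 X (cst c).
Proof.
move=> u _; split=> [y _|i y _] /=; rewrite -[_ \o _]/(cst c); first exact: differentiable_cst.
rewrite (_ : partial_deriv i _ = cst 0); first exact: cst_continuous.
by apply/funext => z; rewrite partial_deriv_cst.
Qed.

Lemma C1_continuous f : C1 X f -> continuous f.
Proof.
move=> Cf x; set c := chart_at X x.
have cx : chart_dom c x by exact: chart_at_dom.
have nx := open_nbhs_nbhs (conj (@chart_dom_open _ _ _ c) cx).
apply: (@near_eq_continuous _ _ _ ((f \o chart_inv c) \o chart_map c)).
  by apply: filterS nx => z cz /=; rewrite chart_mapK.
apply: continuous_comp.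
  have := @chart_map_continuous _ _ _ c.
  by rewrite continuous_open_subspace; [apply; exact: mem_set|exact: chart_dom_open].
exact/differentiable_continuous/C1_differentiable.
Qed.

Lemma C1_measurable f : C1 X f -> measurable_fun [set: borel M] (f : borel M -> R).
Proof.
move=> /C1_continuous/continuousP Cf.
apply: (measurability _ (RGenOpens.measurableE R)).
move=> _ [_ [a [b ->] <-]]; rewrite setTI; apply: sub_sigma_algebra.
exact/Cf/interval_open.
Qed.

End Manifold.

(** * A smooth clipping function *)

Section SmoothClip.
Context (R : realType).
Implicit Types (e t : R).

Definition pos_part t : R := Num.max t 0.

Lemma sqr_pos_part_split t : pos_part t ^+ 2 + pos_part (- t) ^+ 2 = t ^+ 2.
Proof.
rewrite /pos_part; have [t0|t0] := leP t 0.
  by rewrite max_l ?oppr_ge0// expr0n add0r sqrrN.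
by rewrite max_r ?oppr_le0 ?ltW// expr0n addr0.
Qed.

Lemma pos_part_continuous : continuous pos_part.
Proof.
by move=> t; apply: (@continuous_max _ _ id (cst 0)) => //; exact: cst_continuous.
Qed.

Lemma is_derive_sqr_pos_part t :
  is_derive t 1 (fun s => pos_part s ^+ 2) (2 * pos_part t).
Proof.
rewrite /pos_part; have [t0|t0|<-] := ltgtP 0 t.
- apply: (@near_eq_is_derive _ _ _ (fun s : R => s ^+ 2)).
    near=> s; rewrite max_l// ltW//; near: s; exact: lt_nbhsr.
  by apply: is_derive_eq; rewrite /GRing.scale/= mulr1 mulr_natl.
- rewrite mulr0; apply: (@near_eq_is_derive _ _ _ (cst 0)) => //.
  near=> s; rewrite max_r ?expr0n// ltW//; near: s; exact: lt_nbhsl.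
- rewrite mulr0.
  have H : (fun h : R => h^-1 *: (((fun s : R => Num.max s 0 ^+ 2) \o shift 0)
      (h *: (1 : R)) - Num.max 0 0 ^+ 2)) @ 0^' --> (0 : R).
    (* At 0 the difference quotient with step [h] is exactly [pos_part h], which tends to 0. *)
    have /continuous_withinNx := @pos_part_continuous 0.
    rewrite (_ : pos_part 0 = 0); last exact: maxxx.
    apply: cvg_trans; apply: near_eq_cvg; near=> s; have s0 : s != 0 by near: s; exact: nbhs_dnbhs_neq.
    rewrite /= addr0 /GRing.scale/= mulr1 maxxx expr0n subr0 /pos_part.
    have [s1|s1] := leP s 0; first by rewrite expr0n mulr0.
    by rewrite expr2 mulKf.
  by apply: DeriveDef; [apply/cvg_ex; exists 0|exact: cvg_lim].
Unshelve. all: by end_near. Qed.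

(** The distribution function of a sum of two independent variables, uniform on [0,a] and on [0,b].
    Its density [dclip] is the trapezoid obtained by convolving the two uniform densities. Writing
    both through positive parts makes [clip] explicitly C^1. *)
Definition clip (a b t : R) : R := (pos_part t ^+ 2 - pos_part (t - a) ^+ 2
  - pos_part (t - b) ^+ 2 + pos_part (t - a - b) ^+ 2) / (2 * a * b).

Definition dclip (a b t : R) : R := (pos_part t - pos_part (t - a)
  - pos_part (t - b) + pos_part (t - a - b)) / (a * b).

Lemma is_derive_clip (a b t : R) : is_derive t 1 (clip a b) (dclip a b t).
Proof.
have sh c : is_derive t 1 (fun s => pos_part (s - c) ^+ 2) (2 * pos_part (t - c)).
  rewrite -[2 * _]mulr1.
  apply: (@is_derive1_comp _ (fun s => pos_part s ^+ 2) (fun s => s - c)).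
    exact: is_derive_sqr_pos_part.
  by apply: is_derive_eq; rewrite subr0.
have := sh 0; rewrite subr0; under eq_fun do rewrite subr0; move=> h0.
have hab : is_derive t 1 (fun s => pos_part (s - a - b) ^+ 2) (2 * pos_part (t - a - b)).
  by have := sh (a + b); under eq_fun do rewrite opprD addrA; rewrite opprD addrA.
have ha := sh a; have hb := sh b.
have := is_deriveZ (2 * a * b)^-1 (is_deriveD (is_deriveB (is_deriveB h0 ha) hb) hab).
set f := _ \*: _; have -> : f = clip a b.
  by apply/funext => s; rewrite /clip [RHS]mulrC.
move=> H; apply: (@is_derive_eq _ _ _ _ _ _ _ _ H).
rewrite /GRing.scale/= /dclip -!mulrBr -mulrDr mulrA [RHS]mulrC; congr (_ * _).
by rewrite -(mulrA 2) invfM mulrAC mulVf ?mul1r.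
Qed.

Ltac split_pos_parts t a b := rewrite /pos_part;
  case: (leP t 0) => ?; case: (leP (t - a) 0) => ?;
  case: (leP (t - b) 0) => ?; case: (leP (t - a - b) 0) => ?.

Lemma continuous_dclip (a b : R) : continuous (dclip a b).
Proof.
have cp c : continuous (fun s => pos_part (s - c)).
  move=> t; apply: (@continuous_comp _ _ _ (fun s => s - c) pos_part).
    by apply: continuousB; [exact: id|exact: cst_continuous].
  exact: pos_part_continuous.
have cp2 : continuous (fun s => pos_part (s - a - b)).
  by have := cp (a + b); under eq_fun do rewrite opprD addrA.
move=> t; apply: cvgM; last exact: cvg_cst.
apply: cvgD; last exact: cp2.
by apply: cvgB; [apply: cvgB; [exact: pos_part_continuous|exact: cp]|exact: cp].
Qed.

Lemma dclip_bounds (a b t : R) : 0 < a -> 0 < b -> 0 <= dclip a b t <= b^-1.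
Proof.
move=> a0 b0; rewrite /dclip.
rewrite ler_pdivrMr ?mulr_gt0// mulrCA mulVf ?gt_eqF// mulr1.
rewrite ler_pdivlMr ?mulr_gt0// mul0r.
by apply/andP; split_pos_parts t a b; split; lra.
Qed.

Lemma dclip_eq0 (a b t : R) : 0 < a -> 0 < b -> a + b = 1 -> t <= 0 \/ 1 <= t ->
  dclip a b t = 0.
Proof.
move=> a0 b0 ab t01; rewrite /dclip (_ : _ + _ = 0) ?mul0r//.
by case: t01 => ?; split_pos_parts t a b; lra.
Qed.

Lemma clip_le0 (a b t : R) : 0 < a -> 0 < b -> t <= 0 -> clip a b t = 0.
Proof.
move=> a0 b0 t0; rewrite /clip (_ : _ + _ = 0) ?mul0r//.
by split_pos_parts t a b; nra.
Qed.

Lemma clip_ge1 (a b t : R) : 0 < a -> 0 < b -> a + b = 1 -> 1 <= t ->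
  clip a b t = 1.
Proof.
move=> a0 b0 ab t1; rewrite /clip (_ : _ + _ = 2 * a * b) ?divff ?mulf_neq0 ?gt_eqF//.
by rewrite /pos_part !max_l; [ring|lra..].
Qed.

Lemma clip_bounds (a b t : R) : 0 < a -> 0 < b -> a + b = 1 ->
  0 <= clip a b t <= 1.
Proof.
move=> a0 b0 ab; have c0 : 0 < 2 * a * b by rewrite !mulr_gt0.
rewrite /clip ler_pdivrMr// mul1r ler_pdivlMr// mul0r.
by apply/andP; split_pos_parts t a b; split; nra.
Qed.

(** The affine clip between [a] and [b] has slope [(b - a)^-1] but has corners. Rounding them by
    [clip e (1 - e)] costs only the factor [(1 - e)^-1], which can be brought as close to 1 as
    desired. *)
Lemma smooth_step (a b e : R) : a < b -> 0 < e -> e < 1 ->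
  exists h : R -> R, [/\ forall t, derivable h t 1,
    continuous (derive1 h),
    forall t, `|derive1 h t| <= ((1 - e) * (b - a))^-1,
    forall t, t <= a \/ b <= t -> derive1 h t = 0 &
    [/\ forall t, t <= a -> h t = 0, forall t, b <= t -> h t = 1 &
      forall t, 0 <= h t <= 1]].
Proof.
move=> ab e0 e1; have ba0 : 0 < b - a by rewrite subr_gt0.
have e10 : 0 < 1 - e by rewrite subr_gt0.
have e11 : e + (1 - e) = 1 by rewrite addrC subrK.
pose l (t : R) := (t - a) / (b - a).
have dl (t : R) : is_derive t 1 l (b - a)^-1.
  by apply: is_derive_eq; rewrite /GRing.scale/= !mulr0 subr0 add0r mulr1.
have dh (t : R) : is_derive t 1 (clip e (1 - e) \o l) (dclip e (1 - e) (l t) * (b - a)^-1).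
  by apply: is_derive1_comp; exact: is_derive_clip.
have dhE t : derive1 (clip e (1 - e) \o l) t = dclip e (1 - e) (l t) * (b - a)^-1.
  by rewrite derive1E derive_val.
have lle0 t : (l t <= 0) = (t <= a) by rewrite /l ler_pdivrMr// mul0r subr_le0.
have lge1 t : (1 <= l t) = (b <= t) by rewrite /l ler_pdivlMr// mul1r lerD2r.
exists (clip e (1 - e) \o l); split => [t||t|t tab|].
- by have [] := dh t.
- have -> : derive1 (clip e (1 - e) \o l) =
      (fun t => dclip e (1 - e) (l t) * (b - a)^-1).
    exact/funext/dhE.
  move=> t; apply: cvgM; last exact: cvg_cst.
  apply: (@continuous_comp _ _ _ l (dclip e (1 - e))); last exact: continuous_dclip.
  by apply: differentiable_continuous; exact/derivable1_diffP.
- have /andP[d0 d1] := dclip_bounds (l t) e0 e10.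
  have i0 : 0 <= (b - a)^-1 by rewrite invr_ge0 ltW.
  by rewrite dhE ger0_norm; [rewrite invfM ler_wpM2r|rewrite mulr_ge0].
- by rewrite dhE dclip_eq0 ?mul0r// lle0 lge1.
- by split=> t; [move=> ta; apply: clip_le0; rewrite ?lle0
    |move=> bt; apply: clip_ge1; rewrite ?lge1|exact: clip_bounds].
Qed.

End SmoothClip.

(** * Energies and capacities *)

Section Energy.
Context (R : realType) (n : nat) (M : ptopologicalType).
Variable X : riemannian_manifold R n M.
Variable nu : {measure set (borel M) -> \bar R}.
Implicit Types (f g u : M -> R) (h : R -> R).
Local Open Scope ereal_scope.

Definition energy_on (A : set (borel M)) f : \bar R :=
  \int[nu]_(x in A) (sqnorm_grad X f x)%:E.

Lemma energy_on_ge0 A f : 0 <= energy_on A f.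
Proof. by apply: integral_ge0 => x _; rewrite lee_fin sqnorm_grad_ge0. Qed.

Lemma eq_energy_on A B f g : A = B -> sqnorm_grad X f =1 sqnorm_grad X g ->
  energy_on A f = energy_on B g.
Proof. by move=> -> fg; apply: eq_integral => x _; rewrite fg. Qed.

Lemma energy_on_disjoint_le A B f : measurable A -> measurable B ->
  [disjoint A & B] -> energy_on A f + energy_on B f <= energy X nu f.
Proof.
move=> mA mB AB; have sf x : 0 <= (sqnorm_grad X f x)%:E.
  by rewrite lee_fin sqnorm_grad_ge0.
rewrite /energy_on -(integral_setU_ge0 nu mA mB AB sf).
by apply: integral_setT_ge0 => //; exact: measurableU.
Qed.

Lemma energy_on_subset A B f : A `<=` B -> energy_on A f <= energy_on B f.
Proof.
move=> AB; rewrite /energy_on [leLHS]integral_mkcond [leRHS]integral_mkcond.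
apply: le_integral_ge0 => x.
  by apply: erestrict_ge0 => y _; rewrite lee_fin sqnorm_grad_ge0.
rewrite !patchE; have [/set_mem/AB/mem_set -> //|_] := boolP (x \in A).
by case: ifP => // _; rewrite lee_fin sqnorm_grad_ge0.
Qed.

Lemma energy_ge0 f : 0 <= energy X nu f.
Proof. exact: energy_on_ge0. Qed.

(** By the chain rule the squared norm of the gradient is multiplied by the square of
    [derive1 h (f x)], which is at most [k ^+ 2] on [A] and zero off [A]. The set [A] may be
    arbitrary. *)
Lemma energy_comp_le h f (A : set (borel M)) (k : R) :
  (forall t, derivable h t 1%R) -> C1 X f -> (forall t, `|derive1 h t| <= k)%R ->
  (forall x, ~ A x -> derive1 h (f x) = 0%R) ->
  energy X nu (h \o f) <= (k ^+ 2)%:E * energy_on A f.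
Proof.
move=> dh Cf hk hA; have sf x : 0 <= (sqnorm_grad X f x)%:E.
  by rewrite lee_fin sqnorm_grad_ge0.
have k0 : (0 <= k)%R by apply: le_trans (hk 0%R).
rewrite /energy_on integral_mkcond.
set g := (X in \int[nu]_x X x).
have g0 x : 0 <= g x by apply: erestrict_ge0.
apply: le_trans (integralZ_ge0_le _ g0 (sqr_ge0 k)); apply: le_integral_ge0 => x.
  by rewrite lee_fin sqnorm_grad_ge0.
rewrite (sqnorm_gradZ (grad_comp x dh Cf)) EFinM /g patchE.
have [_|/negP xA] := boolP (x \in A).
  by apply: lee_wpmul2r => //; rewrite lee_fin -[leLHS]real_normK ?num_real// lerXn2r ?nnegrE.
by rewrite hA ?expr0n ?mul0e ?mule0// => /mem_set.
Qed.

Lemma energyZ_le f (k : R) : C1 X f ->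
  energy X nu (fun x => k * f x)%R <= (k ^+ 2)%:E * energy X nu f.
Proof.
move=> Cf; rewrite -real_normK ?num_real//.
have dk (t : R) : is_derive t (1 : R)%R (fun s : R => k * s)%R k.
  by apply: is_derive_eq; rewrite /GRing.scale/= mulr1.
apply: (@energy_comp_le (fun s => k * s)%R f setT) => // [t|x].
  by rewrite derive1E derive_val.
by move=> /(_ I).
Qed.

Lemma C1Z f (k : R) : C1 X f -> C1 X (fun x => k * f x)%R.
Proof.
move=> Cf; have dk (t : R) : is_derive t (1 : R)%R (fun s : R => k * s)%R k.
  by apply: is_derive_eq; rewrite /GRing.scale/= mulr1.
apply: (@C1_comp _ _ _ _ (fun s => k * s)%R) => //.
rewrite (_ : derive1 _ = cst k); first exact: cst_continuous.
by apply/funext => t; rewrite derive1E derive_val.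
Qed.

Lemma C1_sum (I : Type) (s : seq I) (g : I -> M -> R) :
  (forall i, C1 X (g i)) -> C1 X (fun x => \sum_(i <- s) g i x)%R.
Proof.
move=> Cg; elim: s => [|i s ih].
  by rewrite (_ : (fun _ => _) = cst 0%R); [exact: C1_cst|apply/funext => x; rewrite big_nil].
rewrite (_ : (fun _ => _) = g i \+ (fun x => \sum_(j <- s) g j x))%R; first exact: C1D.
by apply/funext => x; rewrite big_cons.
Qed.

Lemma grad_sum (I : Type) (s : seq I) (g : I -> M -> R) x :
  (forall i, C1 X (g i)) ->
  grad X (fun x => \sum_(i <- s) g i x)%R x = (\sum_(i <- s) grad X (g i) x)%R.
Proof.
move=> Cg; elim: s => [|i s ih].
  rewrite big_nil (_ : (fun _ => _) = cst 0%R); first exact: grad_cst.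
  by apply/funext => z; rewrite big_nil.
rewrite (_ : (fun _ => _) = g i \+ (fun x => \sum_(j <- s) g j x))%R.
  by rewrite gradD ?ih ?big_cons//; exact: C1_sum.
by apply/funext => z; rewrite big_cons.
Qed.

(** The gradient of the sum vanishes off the union of the disjoint sets [B i], and on [B i] it
    reduces to the gradient of [g i]; no cross terms appear. *)
Lemma energy_sum_le (K : choiceType) (s : seq K) (g : K -> M -> R)
    (B : K -> set (borel M)) : uniq s -> (forall i, C1 X (g i)) ->
  (forall i, measurable (B i)) -> trivIset setT B ->
  (forall i x, i \in s -> ~ B i x -> grad X (g i) x = 0%R) ->
  energy X nu (fun x => \sum_(i <- s) g i x)%R <= \sum_(i <- s) energy X nu (g i).
Proof.
move=> us Cg mB tB gB; pose f x := (\sum_(i <- s) g i x)%R.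
have sf x : 0 <= (sqnorm_grad X f x)%:E by rewrite lee_fin sqnorm_grad_ge0.
have -> : energy X nu f = energy_on (\big[setU/set0]_(i <- s) B i) f.
  rewrite /energy_on integral_mkcond; apply: eq_integral => x _; rewrite patchE.
  have [//|/negP xB] := boolP (x \in _).
  rewrite sqnorm_grad_eq0// grad_sum// big_seq big1// => i si.
  apply: gB => // Bx; apply: xB; apply: mem_set; rewrite -bigcup_seq; by exists i.
have := @integral_bigsetU_ge0 _ _ _ nu _ B (fun x => (sqnorm_grad X f x)%:E) s mB us
  (sub_trivIset (@subsetT _ _) tB) sf.
rewrite /energy_on => ->.
rewrite [X in X <= _]big_seq.
rewrite [X in _ <= X]big_seq.
apply: lee_sum => i si.
rewrite -/(energy_on _ _); apply: (@le_trans _ _ (energy_on (B i) (g i))).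
  rewrite le_eqVlt; apply/orP; left; apply/eqP; apply: eq_integral => x /set_mem xB.
  congr EFin; apply: eq_sqnorm_grad; rewrite grad_sum// (bigD1_seq i)//=.
  rewrite big_seq_cond big1 ?addr0// => j /andP[js ji].
  apply: gB => // xBj; move: tB => /trivIsetP/(_ j i I I ji) /seteqP[+ _].
  by move=> /(_ x); apply.
apply: integral_setT_ge0; first exact: mB.
by move=> x; rewrite lee_fin sqnorm_grad_ge0.
Qed.

Lemma capacity_ge0 A B : 0 <= capacity X nu A B.
Proof. by apply: le_ereal_inf_tmp => _ [f _ <-]; exact: energy_ge0. Qed.

(** The test function is [u] clipped smoothly between [a] and [b]. Its energy lives on the layer
    between the two levels, with the factor [((1 - e) * (b - a)) ^- 2]; then [e] tends to 0. *)
Lemma capacity_level_le u (a b : R) : C1 X u -> (a < b)%R ->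
  capacity X nu [set x | b <= u x]%R [set x | a <= u x]%R <=
  ((b - a) ^- 2)%:E * energy_on [set x | a < u x < b]%R u.
Proof.
move=> Cu ab; set A := [set x | a < u x < b]%R.
have ba0 : (0 < b - a)%R by rewrite subr_gt0.
have main (e : R) : (0 < e)%R -> (e < 1)%R ->
    capacity X nu [set x | b <= u x]%R [set x | a <= u x]%R <=
    (((1 - e) * (b - a)) ^- 2)%:E * energy_on A u.
  move=> e0 e1; have [h [dh Ch hL h0 [ha hb h01]]] := smooth_step ab e0 e1.
  apply: (@le_trans _ _ (energy X nu (h \o u))).
    apply: ereal_inf_lbound; exists (h \o u); last by [].
    split; first exact: (C1_comp dh Ch Cu).
    move=> x; have /andP[h0x h1x] := h01 (u x); rewrite !indicE; apply/andP; split.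
      by have [/set_mem bu|//] := boolP (x \in [set y | (b <= u y)%R]); rewrite /= hb.
    have [_|/negP au] := boolP (x \in [set y | (a <= u y)%R]); first exact: h1x.
    rewrite /= ha// leNgt; apply/negP => au'; apply: au.
    by apply: mem_set; exact: ltW.
  rewrite -exprVn; apply: (energy_comp_le dh Cu hL) => x /negP/nandP uA; apply: h0.
  by case: uA; rewrite -leNgt => ?; [left|right].
have [->|Efin] := eqVneq (energy_on A u) +oo.
  by rewrite gt0_muley ?leey// lte_fin invr_gt0 exprn_gt0.
have {}Efin : energy_on A u \is a fin_num by rewrite ge0_fin_numE ?ltey// energy_on_ge0.
(* The choice [e = 1/2] already shows that the capacity is finite, so the limit can be taken in the
   reals, with the denominator cleared. *)
have /fineK cE : capacity X nu [set x | b <= u x]%R [set x | a <= u x]%R \is a fin_num.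
  rewrite ge0_fin_numE ?capacity_ge0//.
  have h0 : (0 < 2^-1 :> R)%R by [].
  apply: (le_lt_trans (main 2^-1%R h0 _)); first lra.
  by rewrite lte_mul_pinfty// ?lee_fin ?invr_ge0 ?sqr_ge0 ?ltey_eq ?Efin.
move: main; rewrite -cE -(fineK Efin) => main.
set c := fine (capacity _ _ _ _) in main *; set E := fine (energy_on _ _) in main *.
rewrite -EFinM lee_fin mulrC ler_pdivlMr ?exprn_gt0//.
have lim : (c * ((1 - e) * (b - a)) ^+ 2)%R @[e --> (0:R)^'+] --> (c * ((1 - 0) * (b - a)) ^+ 2)%R.
  apply: cvg_at_right_filter.
  apply: cvgM; [exact: cvg_cst|]; apply: cvgM; apply: cvgM; try exact: cvg_cst;
  by apply: cvgB; [exact: cvg_cst|exact: cvg_id].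
rewrite subr0 mul1r in lim; rewrite -(cvg_lim _ lim)//.
apply: limr_le; first by apply/cvg_ex; eexists; exact: lim.
near=> e.
have e0 : (0 < e)%R by near: e; exact: nbhs_right_gt.
have e1 : (e < 1)%R by near: e; exact: nbhs_right_lt.
have := main e e0 e1; rewrite -EFinM lee_fin mulrC ler_pdivlMr//.
by rewrite exprn_gt0// mulr_gt0// subr_gt0.
Unshelve. all: by end_near. Qed.

End Energy.

(** * Variance of bounded random variables *)

Section BoundedVariance.
Context d (T : measurableType d) (R : realType) (P : probability T R).
Implicit Types (Y : T -> R) (k c : R).
Local Open Scope ereal_scope.

Lemma bounded_Lfun2 Y k : measurable_fun [set: T] Y ->
  (forall x, `|Y x| <= k)%R -> Y \in Lfun P 2%:E.
Proof.
move=> mY Yk; rewrite inE; apply/andP; split; rewrite inE//=.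
rewrite /finite_norm unlock poweR_lty//.
apply: (@le_lt_trans _ _ (\int[P]_x cst (k `^ 2)%:E x)); last first.
  by rewrite integral_cst//= probability_setT mule1 ltry.
apply: ge0_le_integral => //.
- by move=> x _; exact: poweR_ge0.
- apply: (@eq_measurable_fun _ _ _ _ _ (EFin \o (fun x => `|Y x| `^ 2)%R)) => //.
  apply/measurable_EFinP/(measurableT_comp (measurable_powR _)).
  exact: measurableT_comp.
- by move=> x _; rewrite lee_fin ge0_ler_powR// nnegrE (le_trans _ (Yk x)).
Qed.

Lemma bounded_integral_fin_num Y k : measurable_fun [set: T] Y ->
  (forall x, `|Y x| <= k)%R -> \int[P]_x (Y x)%:E \is a fin_num.
Proof.
move=> mY Yk; have := expectation_fin_num (Lfun_subset12 _ (bounded_Lfun2 mY Yk)).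
by rewrite unlock; apply; rewrite fin_num_measure.
Qed.

(** The variance does not change when [c] is subtracted, and it is a second moment minus the square
    of a mean. *)
Lemma variance_bounded_le Y k c : measurable_fun [set: T] Y ->
  (forall x, `|Y x| <= k)%R -> variance P Y <= \int[P]_x ((Y x - c) ^+ 2)%:E.
Proof.
move=> mY Yk; have Y2 := bounded_Lfun2 mY Yk.
rewrite -(varianceB_cst_r c Y2) varianceE; last first.
  apply: (@bounded_Lfun2 _ (k + `|c|)); first exact: measurable_funB.
  by move=> x; rewrite (le_trans (ler_normB _ _))// lerD2r.
rewrite unlock; apply: (@le_trans _ _ ('E_P[(Y \- cst c) ^+ 2])).
  by rewrite unlock geeDl// oppe_le0 sqre_ge0.
by rewrite unlock.
Qed.

(** Let [c] be the mean. Off [A], a set of mass at least 1/2, the squared deviation equals [c ^+ 2],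
    so [c ^+ 2] is at most twice the variance. The second moment is the variance plus [c ^+ 2],
    whence the constant 3. *)
Lemma sqr_integral_le_variance Y k (A : set T) : measurable A ->
  P A <= 2^-1%:E -> measurable_fun [set: T] Y ->
  (forall x, `|Y x| <= k)%R -> (forall x, ~ A x -> Y x = 0%R) ->
  \int[P]_x (Y x ^+ 2)%:E <= 3%:E * variance P Y.
Proof.
move=> mA PA mY Yk YA; have Y2 := bounded_Lfun2 mY Yk.
have EYfin := bounded_integral_fin_num mY Yk.
pose c := fine (\int[P]_x (Y x)%:E).
have Vc : (2^-1 * c ^+ 2)%:E <= variance P Y.
  rewrite /variance unlock unlock.
  apply: (@le_trans _ _ (\int[P]_x (c ^+ 2 * \1_(~` A) x)%:E)).
    under eq_integral do rewrite EFinM.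
    rewrite ge0_integralZl//; last by rewrite lee_fin sqr_ge0.
      rewrite integral_indic ?setIT//; last exact: measurableC.
      rewrite /= probability_setC// mulrC EFinM; apply: lee_wpmul2l.
        by rewrite lee_fin sqr_ge0.
      have PAfin : P A \is a fin_num by rewrite fin_num_measure.
      by rewrite -(fineK PAfin) in PA *; rewrite -EFinB lee_fin; rewrite lee_fin in PA; lra.
    by apply/measurable_EFinP/measurable_indic/measurableC.
  apply: ge0_le_integral => //.
  - by move=> x _; rewrite lee_fin mulr_ge0 ?sqr_ge0.
  - apply/measurable_EFinP/measurable_funM => //.
    exact/measurable_indic/measurableC.
  - apply/measurable_EFinP; apply: measurable_funM; exact: measurable_funB.
  - move=> x _; rewrite lee_fin indicE -[leRHS]/((Y x - c) * (Y x - c))%R -expr2.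
    have [/set_mem xA|_] := boolP (x \in _); last by rewrite mulr0 sqr_ge0.
    by rewrite YA// sub0r sqrrN mulr1.
have Y2fin : \int[P]_x (Y x ^+ 2)%:E \is a fin_num.
  apply: (@bounded_integral_fin_num _ (k ^+ 2)); first exact: measurable_funX.
  by move=> x; rewrite normrX lerXn2r ?nnegrE// (le_trans _ (Yk x)).
have : variance P Y = \int[P]_x (Y x ^+ 2)%:E - (c ^+ 2)%:E.
  by rewrite varianceE// unlock EFin_expe fineK.
move: Y2fin Vc => /fineK <-; move: (fine _) => J /[swap] -> .
by rewrite -EFinB -EFinM !lee_fin; lra.
Qed.

End BoundedVariance.

(** * Powers and the terms of beta_P *)

Section Powers.
Context (R : realType).
Implicit Types (x y r q m e c C S B w E Y : R).

(** By homogeneity: the ratio of [x] or [y] to [x + y] lies in [0,1], so its power with exponent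
    [r >= 1] is at most the ratio itself, and the two ratios add up to 1. *)
Lemma powR_superadd r x y : 1 <= r -> 0 <= x -> 0 <= y ->
  x `^ r + y `^ r <= (x + y) `^ r.
Proof.
move=> r1 x0 y0; have r0 : r != 0 by rewrite gt_eqF// (lt_le_trans ltr01).
have [s0|s0] := leP (x + y) 0.
  have -> : x = 0 by lra.
  have -> : y = 0 by lra.
  by rewrite !addr0 powR0// addr0.
have term z : 0 <= z <= x + y -> z `^ r <= z / (x + y) * (x + y) `^ r.
  move=> /andP[z0 zs]; have [->|zn0] := eqVneq z 0.
    by rewrite powR0// !mul0r.
  have zs0 : 0 < z / (x + y) by rewrite divr_gt0// lt_neqAle eq_sym zn0.
  rewrite -{1}(divfK (lt0r_neq0 s0) z) powRM ?(ltW zs0) ?(ltW s0)//.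
  rewrite ler_wpM2r ?powR_ge0//.
  rewrite -[leRHS]powRr1 ?(ltW zs0)//; apply: ger_powR => //.
  by rewrite zs0 ler_pdivrMr// mul1r.
apply: (le_trans (lerD (term x _) (term y _))); [lra|lra|].
by rewrite -!mulrDl divff ?mul1r// gt_eqF.
Qed.

Lemma powR_sum_superadd (I : eqType) (s : seq I) (g : I -> R) r : 1 <= r ->
  (forall i, i \in s -> 0 <= g i) ->
  \sum_(i <- s) g i `^ r <= (\sum_(i <- s) g i) `^ r.
Proof.
move=> r1; elim: s => [_|i s ih g0]; first by rewrite !big_nil powR_ge0.
have gs j : j \in s -> 0 <= g j by move=> js; rewrite g0// inE js orbT.
rewrite !big_cons; apply: le_trans (powR_superadd r1 (g0 i (mem_head _ _)) _).
  by rewrite lerD2l ih.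
by rewrite big_seq; apply: sumr_ge0.
Qed.

(** The real-valued form of a summand of [beta_P], with mass [m] and capacity [c]. *)
Definition cap_term q m c : R := m `^ (1 - q)^-1 / c `^ (q / (1 - q)).

Lemma cap_term_ge0 q m c : 0 <= cap_term q m c.
Proof. by rewrite divr_ge0 ?powR_ge0. Qed.

(** The mass is thus a weighted geometric mean of the term and the capacity, which is the form
    needed for Young's inequality. *)
Lemma cap_termK q m c : q < 1 -> 0 <= m -> 0 < c ->
  cap_term q m c `^ (1 - q) * c `^ q = m.
Proof.
move=> q1 m0 c0; have q10 : 1 - q != 0 by rewrite subr_eq0 gt_eqF.
rewrite /cap_term powRM ?invr_ge0 ?powR_ge0//.
rewrite -[(c `^ _)^-1]powR_inv1 ?powR_ge0// -!powRrM mulVf// powRr1//.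
rewrite mulN1r mulrN divfK// powRN divfK//.
by rewrite gt_eqF// powR_gt0.
Qed.

(** Let a be the term. If d^2 = a / c, then d^2 c = a by definition, and this lemma says that d^(2q)
    m = a as well: the same weight balances energy and mass. *)
Lemma cap_term_div q m c : q < 1 -> 0 <= m -> 0 < c ->
  m * (cap_term q m c / c) `^ q = cap_term q m c.
Proof.
move=> q1 m0 c0; have q10 : 1 - q != 0 by rewrite subr_eq0 gt_eqF.
have [q0|qn0] := eqVneq q 0.
  by rewrite /cap_term q0 !powRr0// mul0r powRr0 subr0 invr1 powRr1// invr1.
have t0 := cap_term_ge0 q m c.
rewrite -{1}(cap_termK q1 m0 c0) powRM ?invr_ge0 ?(ltW c0)//.
rewrite -[c^-1]powR_inv1 ?(ltW c0)// -powRrM mulN1r powRN.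
rewrite mulrACA divff ?mulr1 ?gt_eqF ?powR_gt0//.
by rewrite -powRD ?subrK ?powRr1// oner_eq0.
Qed.

(** Young's inequality with exponents 1/q and 1/(1-q), applied to m = (T c)^q (U a)^(1-q), where a
    is the term. The factor U = T^(-q/(1-q)) is determined by T^q U^(1-q) = 1. *)
Lemma young_cap_term q m c w T : 0 < q -> q < 1 -> 0 <= m -> 0 < c -> 0 <= w -> 0 < T ->
  w * m <= q * T * (w * c) + (1 - q) * T `^ (- (q / (1 - q))) * (w * cap_term q m c).
Proof.
move=> q0 q1 m0 c0 w0 T0; have q10 : 0 < 1 - q by rewrite subr_gt0.
set U := T `^ _; set a := cap_term q m c.
have U0 : 0 < U by rewrite powR_gt0.
have Ba0 : 0 <= U * a by rewrite mulr_ge0 ?cap_term_ge0// ltW.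
have Tc0 : 0 <= T * c by rewrite mulr_ge0// ltW.
have := @conjugate_powR _ ((T * c) `^ q) ((U * a) `^ (1 - q)) q^-1 (1 - q)^-1
  (powR_ge0 _ _) (powR_ge0 _ _).
rewrite !invr_gt0 !invrK => /(_ q0 q10 (subrKC _ _)).
rewrite -!powRrM !divff ?gt_eqF// !powRr1//.
have -> : (T * c) `^ q * (U * a) `^ (1 - q) = m.
  rewrite -[RHS](cap_termK q1 m0 c0) -/a.
  rewrite (powRM _ (ltW T0) (ltW c0)) (powRM _ (ltW U0) (cap_term_ge0 q m c)).
  rewrite /U -powRrM mulNr divfK ?gt_eqF// powRN.
  rewrite [LHS](AC (2*2) ((1*3)*(4*2)))/= divff ?mul1r// gt_eqF// powR_gt0//.
move=> /(ler_wpM2l w0) h; apply: le_trans h _; rewrite le_eqVlt; apply/orP; left; apply/eqP.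
ring.
Qed.

(** The left side of the hypothesis grows with exponent 1/q > 1. Dividing by [S] leaves a bound on
    S^(1/q - 1), which is raised to the power q/(1-q). *)
Lemma powR_le_linear q C S : 0 < q -> q < 1 -> 0 <= S ->
  (S / 3) `^ q^-1 <= `|C| * S -> S <= (`|C| * 3 `^ q^-1) `^ (q / (1 - q)).
Proof.
move=> q0 q1; rewrite le_eqVlt => /predU1P[<- _|S0]; first exact: powR_ge0.
have q10 : 0 < 1 - q by rewrite subr_gt0.
rewrite powRM ?invr_ge0 ?(ltW S0)// -[3^-1]powR_inv1// -powRrM mulN1r powRN.
rewrite ler_pdivrMr ?powR_gt0// mulrAC => h.
rewrite -[leLHS]powRr1 ?(ltW S0)// -[X in S `^ X](@divff _ ((1 - q) / q)); last first.
  by rewrite mulf_neq0 ?invr_neq0 ?gt_eqF.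
rewrite invf_div (powRrM S); apply: ge0_ler_powR.
- by rewrite divr_ge0 ?(ltW q0) ?(ltW q10).
- by rewrite nnegrE powR_ge0.
- by rewrite nnegrE mulr_ge0// powR_ge0.
have -> : (1 - q) / q = q^-1 - 1 by rewrite mulrBl divff ?gt_eqF// mul1r.
rewrite powRB; last by rewrite (gt_eqF S0) implybT.
by rewrite powRr1 ?(ltW S0)// ler_pdivrMr.
Qed.

End Powers.

(** * Finiteness of beta_P *)

Lemma int_chain_subset (T : Type) (A : int -> set T) (j k : int) :
  (forall i, A i `<=` A (i + 1)) -> j <= k -> A j `<=` A k.
Proof.
move=> AS jk; rewrite -(subrKC j k).
have : 0 <= k - j by rewrite subr_ge0.
case: (k - j) => // i _; elim: i => [|i ih]; first by rewrite addr0.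
by apply: subset_trans ih _; rewrite -addn1 PoszD addrA; exact: AS.
Qed.

Lemma int_chain_trivIset (T : Type) (A : int -> set T) :
  (forall i, A i `<=` A (i + 1)) ->
  trivIset setT (fun k => A (k + 1) `\` A k).
Proof.
move=> AS; apply/trivIsetP => j k _ _; wlog jk : j k / j < k => [wl jk|_].
  have [jk'|kj] := ltP j k; first exact: wl.
  by rewrite setIC; apply: wl; rewrite ?(eq_sym k)// lt_neqAle eq_sym jk.
apply/seteqP; split => // x [[xj _] [_ xk]]; apply: xk.
by apply: int_chain_subset xj => //; rewrite lezD1.
Qed.

Section BetaFinite.
Context (R : realType) (n : nat) (M : ptopologicalType).
Variable X : riemannian_manifold R n M.
Variable mu : probability (borel M) R.
Variable nu : {measure set (borel M) -> \bar R}.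
Variables (q C : R).
Hypotheses (q_ge : 2^-1 <= q) (q_lt1 : q < 1).
Hypothesis LqP : Lq_poincare X mu nu q C.

Variables (Om : set (borel M)) (Omk : int -> set (borel M)).
Hypotheses (mOm : measurable Om) (Om_half : (mu Om <= 2^-1%:E)%E).
Hypotheses (mOmk : forall k, measurable (Omk k)).
Hypotheses (OmkS : forall k, Omk k `<=` Omk (k + 1)).
Hypotheses (OmkOm : forall k, Omk k `<=` Om).

Let m k := fine (mu (Omk k)).

Let m_ge0 k : 0 <= m k.
Proof. exact: fine_ge0. Qed.

Let q_gt0 : 0 < q.
Proof. by apply: lt_le_trans q_ge. Qed.

(** This is the core of the finiteness proof, for finitely many indices. The numbers [e k] bound the
    energies of the test functions from above, so no capacity has to be attained, and the same bound
    serves when a capacity might be zero. *)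
Lemma sum_cap_term_le (J : seq int) (f : int -> M -> R) (e : int -> R) : uniq J ->
  (forall k, C1 X (f k)) -> (forall k, 0 < e k) ->
  (forall k x, k \in J -> \1_(Omk k) x <= f k x <= \1_(Omk (k + 1)) x) ->
  (forall k, k \in J -> (energy X nu (f k) <= (e k)%:E)%E) ->
  \sum_(k <- J) cap_term q (m k) (e k) <= (`|C| * 3 `^ q^-1) `^ (q / (1 - q)).
Proof.
move=> uJ Cf e0 f01 fe; apply: powR_le_linear => //.
  by apply: sumr_ge0 => k _; exact: cap_term_ge0.
set S := \sum_(k <- J) _.
pose a k := cap_term q (m k) (e k); pose dd k := Num.sqrt (a k / e k).
have a0 k : 0 <= a k by exact: cap_term_ge0.
have d0 k : 0 <= dd k by exact: sqrtr_ge0.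
have de k : dd k ^+ 2 * e k = a k.
  by rewrite sqr_sqrtr ?divfK ?gt_eqF// divr_ge0// ltW.
have dm k : (dd k `^ q) ^+ 2 * m k = a k.
  rewrite -powR_mulrn ?powR_ge0// powRAC powR_mulrn// sqr_sqrtr; last first.
    by rewrite divr_ge0// ltW.
  by rewrite mulrC; exact: cap_term_div.
pose g k x := dd k * f k x; pose F x := \sum_(k <- J) g k x.
have f_ge0 k x : k \in J -> 0 <= f k x.
  by move=> kJ; have /andP[+ _] := f01 k x kJ; apply: le_trans; rewrite indicE.
have F_ge0 x : 0 <= F x.
  by rewrite /F big_seq; apply: sumr_ge0 => k kJ; rewrite mulr_ge0// f_ge0.
have Cg k : C1 X (g k) by exact: C1Z.
have CF : C1 X F by exact: C1_sum.
have EF : (energy X nu F <= S%:E)%E.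
  apply: le_trans (@energy_sum_le _ _ _ X nu _ J g
    (fun k => Omk (k + 1) `\` Omk k) uJ Cg _ (int_chain_trivIset OmkS) _) _.
  - by move=> k; exact: measurableD.
  - move=> k x kJ kx; rewrite [LHS](_ : _ = grad X ((fun t => dd k * t) \o f k) x)//.
    have dk (t : R) : is_derive t (1 : R) (fun s : R => dd k * s) (dd k).
      by apply: is_derive_eq; rewrite /GRing.scale/= mulr1.
    rewrite grad_comp; [|by move=> t; have [] := dk t|exact: Cf].
    rewrite grad_eq0 ?scaler0//.
    (* Off the layer, [f k] takes its maximum 1 (on the inner set) or its minimum 0 (off the outer
       set). *)
    have [xk|xk] := pselect (Omk k x).
      left => z; apply: (@le_trans _ _ 1).
        have /andP[_ +] := f01 k z kJ; move/le_trans; apply.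
        by rewrite indicE; case: (_ \in _).
      by have /andP[+ _] := f01 k x kJ; rewrite indicE mem_set.
    have xk1 : ~ Omk (k + 1) x by move=> xk1; apply: kx.
    right => z; apply: le_trans (f_ge0 k z kJ).
    by have /andP[_ +] := f01 k x kJ; rewrite indicE memNset.
  rewrite /S -sumEFin big_seq [X in (_ <= X)%E]big_seq; apply: lee_sum => k kJ.
  apply: le_trans (energyZ_le _ _ (Cf k)) _; rewrite -/(a k) -(de k) [X in (_ <= X)%E]EFinM.
  by apply: lee_wpmul2l; [rewrite lee_fin sqr_ge0|exact: fe].
pose Y x := F x `^ q.
have mY : measurable_fun [set: borel M] (Y : borel M -> R).
  apply: (measurableT_comp (measurable_powR _)); exact: C1_measurable CF.
have Yk (x : borel M) : `|Y x| <= (\sum_(k <- J) dd k) `^ q.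
  rewrite ger0_norm ?powR_ge0// ge0_ler_powR ?nnegrE ?(ltW q_gt0) ?F_ge0//.
    by apply: sumr_ge0.
  rewrite /F big_seq [leRHS]big_seq; apply: ler_sum => k kJ.
  rewrite /g ler_piMr//; have /andP[_ +] := f01 k x kJ; move/le_trans; apply.
  by rewrite indicE; case: (_ \in _).
have YOm (x : borel M) : ~ Om x -> Y x = 0.
  move=> xOm; rewrite /Y /F big_seq big1 ?powR0 ?gt_eqF// => k kJ.
  have : f k x <= 0.
    by have /andP[_ +] := f01 k x kJ; rewrite indicE memNset// => /OmkOm.
  move=> fk; rewrite /g (_ : f k x = 0) ?mulr0//.
  by apply/eqP; rewrite eq_le fk f_ge0.
have SY : (S%:E <= \int[mu]_x (Y x ^+ 2)%:E)%E.
  apply: (@le_trans _ _ (\int[mu]_x (\sum_(k <- J) ((dd k `^ q) ^+ 2 * \1_(Omk k) x)%:E))%E).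
    rewrite ge0_integral_sum//; last 2 first.
    - move=> k; apply/measurable_EFinP/measurable_funM => //.
    - by move=> k x _; rewrite lee_fin mulr_ge0 ?sqr_ge0.
    rewrite /S -sumEFin; apply: lee_sum => k _.
    under eq_integral do rewrite EFinM.
    rewrite ge0_integralZl//; last first.
    - by rewrite lee_fin sqr_ge0.
    - by apply/measurable_EFinP/measurable_indic.
    rewrite integral_indic// setIT -/(a k) -(dm k) EFinM /m fineK//.
    exact: fin_num_measure.
  apply: ge0_le_integral => //.
  - by move=> x _; apply: sume_ge0 => k _; rewrite lee_fin mulr_ge0 ?sqr_ge0.
  - apply: emeasurable_sum => k; apply/measurable_EFinP/measurable_funM => //.
  - by apply/measurable_EFinP/measurable_funX.
  move=> x _; rewrite sumEFin lee_fin.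
  (* Here 2q >= 1 enters: the power with exponent 2q of the sum dominates the sum of the powers, and
     [f k] is at least 1 on [Omk k]. *)
  have YE (t : R) : 0 <= t -> (t `^ q) ^+ 2 = t `^ (q * 2).
    by move=> t0; rewrite powRrM powR_mulrn ?powR_ge0.
  rewrite /Y YE//; have q2 : 1 <= q * 2 by rewrite -ler_pdivrMr// mul1r.
  apply: (@le_trans _ _ (\sum_(k <- J) g k x `^ (q * 2))); last first.
    by apply: powR_sum_superadd => // k kJ; rewrite mulr_ge0// f_ge0.
  rewrite big_seq [leRHS]big_seq; apply: ler_sum => k kJ.
  rewrite YE// indicE; have [xk|_] := boolP (x \in _); last by rewrite mulr0 powR_ge0.
  rewrite mulr1 ge0_ler_powR ?nnegrE ?(le_trans ler01 q2) ?mulr_ge0 ?f_ge0//.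
  rewrite /g ler_peMr//; have /andP[+ _] := f01 k x kJ; apply: le_trans.
  by rewrite indicE xk.
have V3 := le_trans SY (sqr_integral_le_variance mOm Om_half mY Yk YOm).
have SV : ((S / 3)%:E <= variance mu (Y : borel M -> R))%E.
  by rewrite mulrC EFinM lee_pdivrMl.
rewrite -lee_fin -poweR_EFin.
have S0 : 0 <= S by apply: sumr_ge0 => k _; exact: a0.
have /le_trans : ((S / 3)%:E `^ q^-1 <= variance mu (Y : borel M -> R) `^ q^-1)%E.
  apply: gt0_ler_poweR => //; rewrite ?in_itv/= ?leey ?andbT.
  - by rewrite invr_ge0 ltW.
  - by rewrite lee_fin divr_ge0.
  - exact: variance_ge0.
(* The energy of [F] is finite, so [mul_energy] is an ordinary product. The sign of [C] is not
   prescribed, hence the passage to its absolute value. *)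
apply; apply: le_trans (LqP CF F_ge0) _; rewrite /mul_energy ifF; last first.
  by apply/negbTE; rewrite -ltey (le_lt_trans EF)// ltry.
rewrite EFinM; apply: (@le_trans _ _ (`|C|%:E * energy X nu F)%E).
  by apply: lee_wpmul2r; [exact: energy_ge0|rewrite lee_fin ler_norm].
by apply: lee_wpmul2l => //; rewrite lee_fin.
Qed.

Let K := (`|C| * 3 `^ q^-1) `^ (q / (1 - q)).
Let p_gt0 : 0 < q / (1 - q).
Proof. by rewrite divr_gt0 ?subr_gt0. Qed.

(** If the capacity were zero, a test function would exist with energy below any [eta > 0]. The
    value of [eta] is chosen so that the corresponding term equals [K + 1], against the bound [K]
    for a single index. *)
Lemma capacity_gt0 k : 0 < m k -> (0 < capacity X nu (Omk k) (Omk (k + 1)))%E.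
Proof.
move=> mk; rewrite lt_neqAle capacity_ge0 andbT eq_sym; apply/eqP => c0.
set z := m k `^ (1 - q)^-1; have z0 : 0 < z by rewrite powR_gt0.
have K1 : 0 < K + 1 by rewrite ltr_wpDl// powR_ge0.
pose eta := (z / (K + 1)) `^ ((1 - q) / q).
have eta0 : 0 < eta by rewrite powR_gt0// divr_gt0.
have : (capacity X nu (Omk k) (Omk (k + 1)) < eta%:E)%E by rewrite c0 lte_fin.
move=> /ereal_inf_lt[_ [f [Cf f01] <-] /ltW fe].
have := @sum_cap_term_le [:: k] (fun=> f) (fun=> eta) isT (fun=> Cf) (fun=> eta0).
rewrite big_seq1 -/K => H; have : cap_term q (m k) eta <= K.
  apply: H => [j x|j]; last by [].
  by rewrite inE => /eqP ->; exact: f01.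
have pq : (1 - q) / q * (q / (1 - q)) = 1.
  by rewrite -[q / _]invf_div mulfV// mulf_neq0 ?invr_neq0 ?gt_eqF ?subr_gt0.
rewrite /cap_term -/z /eta -powRrM pq powRr1; last by rewrite divr_ge0 ?ltW.
by rewrite invf_div mulrCA divff ?gt_eqF// mulr1; lra.
Qed.

(** Each finite partial sum is bounded by means of test functions whose energy is at most twice the
    capacity; replacing the capacity by its double costs the factor 2^(q/(1-q)). *)
Lemma esum_cap_le :
  (\esum_(k in [set: int]) (mu (Omk k) `^ (1 - q)^-1
     / capacity X nu (Omk k) (Omk (k + 1)) `^ (q / (1 - q)))
   <= (2 `^ (q / (1 - q)) * K)%:E)%E.
Proof.
set cap := fun k => capacity X nu (Omk k) (Omk (k + 1)).
(* The other indices have zero mass or infinite capacity, and their terms vanish by the conventions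
   of the extended reals. *)
pose good k := (0 < m k) && (cap k < +oo)%E.
have muE k : mu (Omk k) = (m k)%:E by rewrite /m fineK// fin_num_measure.
have r0 : (1 - q)^-1 != 0 by rewrite invr_neq0// gt_eqF// subr_gt0.
have bad k : ~~ good k -> (mu (Omk k) `^ (1 - q)^-1 / cap k `^ (q / (1 - q)) = 0)%E.
  rewrite negb_and -leNgt -leNgt leye_eq => /orP[mk|/eqP ->].
    have -> : mu (Omk k) = 0%E by rewrite muE; congr EFin; apply/le_anti; rewrite mk m_ge0.
    by rewrite poweR0r// mul0e.
  by rewrite poweRyr ?gt_eqF// invey mule0.
have cfin k : good k -> cap k = (fine (cap k))%:E.
  by move=> /andP[_ ck]; rewrite fineK// ge0_fin_numE ?capacity_ge0.
have c0 k : good k -> 0 < fine (cap k).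
  by move=> gk; rewrite -lte_fin -cfin//; apply: capacity_gt0; case/andP: gk.
have termE k : good k ->
    (mu (Omk k) `^ (1 - q)^-1 / cap k `^ (q / (1 - q)) =
     (2 `^ (q / (1 - q)) * cap_term q (m k) (2 * fine (cap k)))%:E)%E.
  move=> gk; rewrite muE cfin// !poweR_EFin inver gt_eqF ?powR_gt0 ?c0// -EFinM.
  congr EFin; rewrite /cap_term powRM ?(ltW (c0 _ gk))// invfM mulrCA.
  by rewrite [2 `^ _ * _]mulrA divff ?mul1r// gt_eqF// powR_gt0.
have /choice[f fP] k : exists f, C1 X f /\ (good k ->
    (forall x, \1_(Omk k) x <= f x <= \1_(Omk (k + 1)) x) /\
    (energy X nu f <= (2 * fine (cap k))%:E)%E).
  have [gk|_] := boolP (good k); last by exists (cst 0); split => //; exact: C1_cst.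
  have : (cap k < (2 * fine (cap k))%:E)%E.
    by rewrite {1}cfin// lte_fin; have := c0 k gk; lra.
  by move=> /ereal_inf_lt[_ [g [Cg g01] <-] /ltW ge]; exists g.
apply: ge_ereal_sup => _ [A [finA _] <-]; rewrite fsbig_finite//=.
set J : seq int := fset_set A; pose J' := [seq k <- J | good k].
have -> : (\sum_(k <- J) (mu (Omk k) `^ (1 - q)^-1 / cap k `^ (q / (1 - q))) =
   \sum_(k <- J') (2 `^ (q / (1 - q)) * cap_term q (m k) (2 * fine (cap k)))%:E)%E.
  rewrite big_filter [RHS]big_mkcond/=; apply: eq_bigr => k _.
  by case: ifPn => gk; [exact: termE|exact: bad].
rewrite sumEFin -mulr_sumr lee_fin ler_wpM2l ?powR_ge0//.
(* The value 1 is a dummy that keeps [e] positive at the indices outside the sum. *)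
pose e k := if good k then 2 * fine (cap k) else 1.
have -> : \sum_(k <- J') cap_term q (m k) (2 * fine (cap k)) =
    \sum_(k <- J') cap_term q (m k) (e k).
  by rewrite !big_filter; apply: eq_bigr => k gk; rewrite /e gk.
have J'good k : k \in J' -> good k by rewrite mem_filter => /andP[].
apply: (@sum_cap_term_le _ f).
- exact/filter_uniq/fset_uniq.
- by move=> k; have [] := fP k.
- by move=> k; rewrite /e; case: ifP => // gk; rewrite mulr_gt0// c0.
- by move=> k x /J'good gk; have [_ /(_ gk)[]] := fP k.
- by move=> k /J'good gk; rewrite /e gk; have [_ /(_ gk)[]] := fP k.
Qed.

End BetaFinite.

(** * The one-sided estimate *)

Section GoldenRatio.
Context (R : realType).

Definition golden : R := (1 + Num.sqrt 5) / 2.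

Lemma golden_sqr : golden ^+ 2 = golden + 1.
Proof.
have s5 : Num.sqrt 5 ^+ 2 = 5 :> R by rewrite sqr_sqrtr.
by rewrite /golden; nra.
Qed.

Lemma golden_bounds : 1 < golden <= 2.
Proof.
have s5 : Num.sqrt 5 ^+ 2 = 5 :> R by rewrite sqr_sqrtr.
have s0 : 0 <= Num.sqrt 5 :> R by exact: sqrtr_ge0.
by rewrite /golden; apply/andP; split; nra.
Qed.

(** The product is kept split: the factor [golden] comes from [layer_cake], the factor [golden ^+ 4]
    from the capacity of a layer. *)
Lemma kappa_golden : kappa R = golden * golden ^+ 4.
Proof.
have s5 : Num.sqrt 5 ^+ 2 = 5 :> R by rewrite sqr_sqrtr.
have -> : golden ^+ 4 = 3 * golden + 2.
  by rewrite -[4%N]/(2 * 2)%N exprM golden_sqr; have := golden_sqr; nra.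
by have := golden_sqr; rewrite /kappa /golden; nra.
Qed.

(** The levels decrease in [z], so that the superlevel sets increase with the index, as the
    sequences in [beta_P] do. *)
Definition level (L : R) (z : int) : R := L * golden ^ (- z).

Let g0 : 0 < golden.
Proof. by have /andP[g1 _] := golden_bounds; lra. Qed.

Lemma level_gt0 L z : 0 < L -> 0 < level L z.
Proof. by move=> L0; rewrite /level mulr_gt0// exprz_gt0. Qed.

Lemma levelS L z : level L z = golden * level L (z + 1).
Proof.
rewrite /level mulrCA; congr (_ * _).
by rewrite opprD -[X in X * _]expr1z -expfzDr ?gt_eqF// addrC subrK.
Qed.

Lemma sqr_pos_part_le (v t : R) : 0 <= t -> v <= t -> pos_part v ^+ 2 <= t ^+ 2.
Proof.
move=> t0 vt; rewrite lerXn2r ?nnegrE /pos_part ?le_max ?lexx ?orbT//.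
by rewrite ge_max vt t0.
Qed.

(** Induction on [N]. If [v] reaches the next level t', the remainder drops from rho^2 t'^2 to t'^2
    while the sum gains rho t'^2; these balance exactly since rho^2 = rho + 1. Otherwise the new
    remainder alone suffices. *)
Lemma layer_cake L v (N : nat) : 0 < L -> v <= L ->
  pos_part v ^+ 2 <= golden * (\sum_(i < N) level L i.+1 ^+ 2 * (level L i.+1 <= v)%R%:R)
    + level L N ^+ 2.
Proof.
move=> L0 vL; elim: N => [|N ih].
  by rewrite big_ord0 mulr0 add0r /level oppr0 expr0z mulr1 sqr_pos_part_le// ltW.
have lN : level L N = golden * level L N.+1 by rewrite levelS -PoszD addn1.
rewrite big_ord_recr/=; have [vN|vN] := leP (level L N.+1) v.
  apply: le_trans ih _; rewrite lN mulr1 exprMn golden_sqr le_eqVlt; apply/orP; left; apply/eqP.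
  ring.
rewrite mulr0 addr0 ler_wpDl//.
  by rewrite mulr_ge0 ?(ltW g0)//; apply: sumr_ge0 => i _; rewrite mulr_ge0 ?sqr_ge0.
by rewrite sqr_pos_part_le ?ltW ?level_gt0.
Qed.

Lemma level_cvg0 L (e : R) : 0 < L -> 0 < e -> exists N : nat, level L N ^+ 2 <= e.
Proof.
move=> L0 e0; have /andP[g1 _] := golden_bounds.
have gV : `|golden^-1 ^+ 2| < 1.
  rewrite ger0_norm ?sqr_ge0// expr_lt1 ?invr_ge0 ?(ltW g0)//.
  by rewrite invf_lt1.
have := @cvg_geometric _ (L ^+ 2) _ gV.
move/cvgrPdist_le => /(_ e e0)[N _ /(_ N (leqnn N))].
rewrite /= sub0r normrN => Ne; exists N; apply: le_trans Ne.
apply: le_trans (ler_norm _); rewrite /geometric/= /level exprMn -exprM mulnC exprM.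
by rewrite exprVn exprnN.
Qed.


End GoldenRatio.

(** * The estimate for one side of the median *)

Section OneSided.
Context (R : realType) (n : nat) (M : ptopologicalType).
Variable X : riemannian_manifold R n M.
Variable mu : probability (borel M) R.
Variable nu : {measure set (borel M) -> \bar R}.
Variables (q B : R).
Hypotheses (q_ge : 2^-1 <= q) (q_lt1 : q < 1) (B_gt0 : 0 < B).
Hypothesis B_bound : forall (Om : set (borel M)) (Omk : int -> set (borel M)),
  measurable Om -> (mu Om <= 2^-1%:E)%E -> (forall k, measurable (Omk k)) ->
  (forall k, Omk k `<=` Omk (k + 1) /\ Omk (k + 1) `<=` Om) ->
  (\esum_(k in [set: int]) (mu (Omk k) `^ (1 - q)^-1
     / capacity X nu (Omk k) (Omk (k + 1)%R) `^ (q / (1 - q)))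
   <= (B `^ (q / (1 - q)))%:E)%E.

Local Notation rho := (golden R).

(** The number [Y] bounds every positive level that [u] reaches with positive mass. Young's
    inequality with weight t_z^2 splits each term t_z^2 mu(A_z) into a part controlled by the energy
    of a layer and a part controlled by Y^2 times a term of [beta_P]. Both parts are summed over the
    levels. *)
Lemma integral_sqr_pos_part_le u (k Y E s : R) : C1 X u -> (forall x, u x <= k) ->
  (mu [set x | (0 < u x)%R] <= 2^-1%:E)%E ->
  0 <= Y -> (forall t, 0 < t -> mu [set x | (t <= u x)%R] != 0%E -> t <= Y) ->
  (energy_on X nu [set x | (0 < u x)%R] u <= E%:E)%E -> 0 < s ->
  (\int[mu]_x (pos_part (u x) ^+ 2)%:E <=
     (kappa R * B * s `^ (1 - q^-1) * E + s * Y ^+ 2)%:E)%E.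
Proof.
move=> Cu uk u_half Y0 uY uE s0.
have q0 : 0 < q by apply: lt_le_trans q_ge.
have q10 : 0 < 1 - q by rewrite subr_gt0.
have /andP[g1 g2] := golden_bounds R.
have g0 : 0 < rho by lra.
have mu_meas (A : set R) : measurable A -> measurable [set x : borel M | A (u x)].
  by move=> mA; rewrite -[X in measurable X]setTI; exact: (C1_measurable Cu).
pose L := `|k| + 1; have L0 : 0 < L by rewrite ltr_wpDl.
have uL x : u x <= L by apply: le_trans (uk x) _; rewrite /L; have := ler_norm k; lra.
pose t (z : int) := level L z; have t0 z : 0 < t z by exact: level_gt0.
pose A (z : int) := [set x : borel M | t z <= u x].
have mA z : measurable (A z).
  rewrite (_ : A z = [set x | `[t z, +oo[%classic (u x)]); first exact: mu_meas.
  by apply/seteqP; split => x /=; rewrite in_itv/= andbT.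
pose C (z : int) := [set x : borel M | t (z + 1) < u x < t z].
have mC z : measurable (C z).
  rewrite (_ : C z = [set x | `]t (z + 1), t z[%classic (u x)]); first exact: mu_meas.
  by apply/seteqP; split => x /=; rewrite in_itv.
have t_anti z z' : z <= z' -> t z' <= t z.
  by move=> zz; rewrite /t /level ler_pM2l// ler_weXz2l ?lerN2// ltW.
have AS z : A z `<=` A (z + 1).
  by move=> x; rewrite /A/=; apply: le_trans; apply: t_anti; rewrite lerDl.
have A0 z : A z `<=` [set x | 0 < u x] by move=> x; apply: lt_le_trans.
have tC : trivIset setT C.
  apply/trivIsetP => z z' _ _; wlog zz : z z' / z < z' => [wl ne|_].
    have [zz|zz] := ltP z z'; first exact: wl.
    by rewrite setIC; apply: wl; rewrite ?(eq_sym z')// lt_neqAle eq_sym ne.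
  apply/seteqP; split => // x [/andP[xz _] /andP[_ xz']].
  have := lt_trans xz xz'; rewrite ltNge => /negP; apply.
  by apply: t_anti; rewrite lezD1.
pose e z := fine (energy_on X nu (C z) u).
have eE z : energy_on X nu (C z) u = (e z)%:E.
  rewrite /e fineK// ge0_fin_numE ?energy_on_ge0//.
  apply: le_lt_trans (ltry E); apply: le_trans uE; apply: energy_on_subset.
  by move=> x /andP[xz _]; apply: lt_trans xz.
have e_ge0 z : 0 <= e z by rewrite -lee_fin -eE energy_on_ge0.
pose m z := fine (mu (A z)).
have mE z : mu (A z) = (m z)%:E by rewrite /m fineK// fin_num_measure.
have m_ge0 z : 0 <= m z by exact: fine_ge0.
pose p := q / (1 - q).
pose c z := capacity X nu (A z) (A (z + 1)).
have c_le z : (c z <= (rho ^+ 4 / t z ^+ 2 * e z)%:E)%E.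
  have tS : t z = rho * t (z + 1) by exact: levelS.
  have t1 := t0 (z + 1).
  have tz : t (z + 1) < t z by rewrite tS ltr_pMl.
  apply: le_trans (capacity_level_le _ Cu tz) _; rewrite eE -EFinM lee_fin.
  (* Since rho (rho - 1) = 1, the gap t_z - t_(z+1) = (rho - 1) t_(z+1) equals t_z / rho^2; its
     inverse square is rho^4 / t_z^2. *)
  rewrite ler_wpM2r// le_eqVlt; apply/orP; left; apply/eqP.
  have := golden_sqr R => gg; rewrite tS.
  have -> : rho * t (z + 1) - t (z + 1) = (rho - 1) * t (z + 1) by ring.
  have g10 : rho - 1 != 0 by rewrite gt_eqF// subr_gt0.
  have tn0 : t (z + 1) != 0 by rewrite gt_eqF.
  have gn0 : rho != 0 by rewrite gt_eqF.
  have inv1 : rho * (rho - 1) = 1 by rewrite mulrBr -expr2 gg; ring.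
  have -> : (rho - 1) = rho^-1 by apply: (mulfI gn0); rewrite inv1 mulfV.
  by field; rewrite gn0 tn0.
pose al z := (mu (A z) `^ (1 - q)^-1 / c z `^ p)%E.
have al_ge0 z : (0 <= al z)%E by rewrite mule_ge0 ?inve_ge0 ?poweR_ge0.
have sum_al (s' : seq int) : uniq s' -> (\sum_(z <- s') al z <= (B `^ p)%:E)%E.
  move=> us; apply: le_trans (@B_bound [set x | 0 < u x] A _ u_half mA _).
  - apply: esum_ge; exists [set` s']; first by split; [exact: finite_seq|exact: subsetT].
    by rewrite -fsbig_seq.
  - rewrite (_ : [set _ | _] = [set x | `]0, +oo[%classic (u x)]); first exact: mu_meas.
    by apply/seteqP; split => x /=; rewrite in_itv/= andbT.
  - by move=> z; split; [exact: AS|exact: A0].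
have al_le z : (al z <= (B `^ p)%:E)%E by have := sum_al [:: z] isT; rewrite big_seq1.
pose ar z := fine (al z).
have alE z : al z = (ar z)%:E.
  by rewrite /ar fineK// ge0_fin_numE// (le_lt_trans (al_le z))// ltry.
have ar_ge0 z : 0 <= ar z by exact: fine_ge0.
(* Young's parameter is chosen so that T^(-p) B^p = s, which produces both the power of [s] in front
   of the energy and the factor [s] in front of Y^2. *)
pose T := B * s `^ (1 - q^-1).
have T0 : 0 < T by rewrite mulr_gt0// powR_gt0.
have TB : T `^ (- p) * B `^ p = s.
  rewrite /T powRM ?powR_ge0 ?(ltW B_gt0)// mulrAC -powRD; last first.
    by rewrite (gt_eqF B_gt0) implybT.
  rewrite addNr powRr0 mul1r -powRrM (_ : (1 - q^-1) * - p = 1) ?powRr1 ?(ltW s0)//.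
  by rewrite /p; field; rewrite !gt_eqF.
have term z : t z ^+ 2 * m z <=
    q * T * (rho ^+ 4 * e z) + (1 - q) * T `^ (- p) * (Y ^+ 2 * ar z).
  have [mz|mz] := leP (m z) 0.
    have -> : m z = 0 by apply/le_anti; rewrite mz m_ge0.
    rewrite mulr0; apply: addr_ge0; apply: mulr_ge0.
    - by rewrite mulr_ge0 ?(ltW q0) ?(ltW T0).
    - by rewrite mulr_ge0 ?exprn_ge0 ?(ltW g0).
    - by rewrite mulr_ge0 ?powR_ge0 ?(ltW q10).
    - by rewrite mulr_ge0 ?sqr_ge0.
  have tY : t z <= Y by apply: uY => //; rewrite -/(A z) mE eqe gt_eqF.
  have cE : c z = (fine (c z))%:E.
    by rewrite fineK// ge0_fin_numE ?capacity_ge0// (le_lt_trans (c_le z))// ltry.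
  (* A zero capacity at positive mass would give an infinite term, against [al_le]. *)
  have c0 : 0 < fine (c z).
    rewrite lt_neqAle fine_ge0 ?capacity_ge0// andbT eq_sym; apply/eqP => cz0.
    have := al_le z; rewrite /al cE cz0 poweR0r ?gt_eqF ?divr_gt0// inve0.
    by rewrite gt0_muley ?poweR_gt0 ?mE ?lte_fin// leye_eq.
  have arE : ar z = cap_term q (m z) (fine (c z)).
    by rewrite /ar /al mE cE !poweR_EFin inver gt_eqF ?powR_gt0.
  apply: le_trans (young_cap_term q0 q_lt1 (m_ge0 z) c0 (sqr_ge0 (t z)) T0) _.
  rewrite -arE lerD// ler_wpM2l//.
  - by rewrite mulr_ge0 ?(ltW q0) ?(ltW T0).
  - have := c_le z; rewrite cE lee_fin mulrAC ler_pdivlMr ?exprn_gt0//.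
    by rewrite mulrC.
  - by rewrite mulr_ge0 ?powR_ge0 ?(ltW q10).
  - by rewrite ler_wpM2r// lerXn2r ?nnegrE// ltW.
have E0 : 0 <= E by rewrite -lee_fin (le_trans _ uE) ?energy_on_ge0.
(* Finitely many levels suffice: [N] is such that the remainder t_N^2 is at most [eps]. *)
apply/lee_addgt0Pr => eps eps0; have [N Neps] := @level_cvg0 R L _ L0 eps0.
pose J := [seq Posz i.+1 | i <- index_iota 0 N].
have uJ : uniq J by rewrite map_inj_uniq ?iota_uniq// => i j [].
have JE (g : int -> R) : \sum_(i < N) g i.+1 = \sum_(z <- J) g z.
  by rewrite big_map big_mkord.
have sum_e : \sum_(z <- J) e z <= E.
  rewrite -lee_fin -sumEFin; under eq_bigr do rewrite -eE.
  rewrite -(integral_bigsetU_ge0 nu mC uJ (sub_trivIset (@subsetT _ _) tC)); last first.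
    by move=> x; rewrite lee_fin sqnorm_grad_ge0.
  apply: le_trans uE; apply: energy_on_subset => x.
  rewrite -bigcup_seq => -[z _ /andP[xz _]]; exact: lt_trans xz.
have sum_ar : \sum_(z <- J) ar z <= B `^ p.
  by rewrite -lee_fin -sumEFin; under eq_bigr do rewrite -alE; exact: sum_al.
have -> : ((kappa R * B * s `^ (1 - q^-1) * E + s * Y ^+ 2)%:E + eps%:E =
  (kappa R * B * s `^ (1 - q^-1) * E + s * Y ^+ 2 + eps)%:E)%E by [].
apply: (@le_trans _ _ (\sum_(z <- J) (rho * t z ^+ 2 * m z) + t N ^+ 2)%:E).
  pose h (x : borel M) := ((\sum_(z <- J) (rho * t z ^+ 2 * \1_(A z) x)%:E)
    + cst (t N ^+ 2)%:E x)%E.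
  have term0 z (x : borel M) : (0 <= (rho * t z ^+ 2 * \1_(A z) x)%:E)%E.
    by rewrite lee_fin mulr_ge0// mulr_ge0 ?sqr_ge0 ?(ltW g0).
  have mterm z : measurable_fun [set: borel M]
      (fun x : borel M => (rho * t z ^+ 2 * \1_(A z) x)%:E).
    by apply/measurable_EFinP/measurable_funM => //.
  apply: (@le_trans _ _ (\int[mu]_x h x)%E).
    apply: ge0_le_integral => //.
    - by move=> x _; rewrite lee_fin sqr_ge0.
    - apply/measurable_EFinP/measurable_funX.
      apply: (measurableT_comp _ (C1_measurable Cu)).
      by apply: measurable_maxr => //.
    - by apply: emeasurable_funD => //; exact: emeasurable_sum.
    move=> x _; rewrite /h sumEFin -EFinD lee_fin; apply: le_trans (layer_cake N L0 (uL x)) _.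
    rewrite lerD2r (JE (fun z => level L z ^+ 2 * (level L z <= u x)%R%:R)) mulr_sumr.
    apply: ler_sum => z _; rewrite mulrA; apply: ler_wpM2l.
      by rewrite mulr_ge0 ?sqr_ge0 ?(ltW g0).
    by rewrite indicE; case: (leP (level L z)) => // zu; rewrite mem_set.
  have hs0 (x : borel M) : (0 <= \sum_(z <- J) (rho * t z ^+ 2 * \1_(A z) x)%:E)%E.
    exact: sume_ge0.
  have hc0 (x : borel M) : (0 <= cst (t N ^+ 2)%:E x)%E by rewrite lee_fin sqr_ge0.
  rewrite ge0_integralD//; last exact: emeasurable_sum.
  rewrite integral_cst//= probability_setT mule1 EFinD leeD2r//.
  rewrite ge0_integral_sum// -sumEFin; apply: lee_sum => z _.
  under eq_integral do rewrite EFinM.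
  rewrite ge0_integralZl//; last first.
  - by rewrite lee_fin mulr_ge0 ?sqr_ge0 ?(ltW g0).
  - by apply/measurable_EFinP/measurable_indic.
  rewrite integral_indic// setIT [leRHS]EFinM /m fineK//.
  exact: fin_num_measure.
rewrite lee_fin lerD// kappa_golden.
apply: (@le_trans _ _ (rho * (q * T * (rho ^+ 4 * \sum_(z <- J) e z) +
    (1 - q) * T `^ (- p) * (Y ^+ 2 * \sum_(z <- J) ar z)))).
  rewrite !mulr_sumr -big_split/= mulr_sumr; apply: ler_sum => z _.
  by rewrite -mulrA ler_pM2l.
apply: (@le_trans _ _ (rho * (q * T * (rho ^+ 4 * E) +
    (1 - q) * T `^ (- p) * (Y ^+ 2 * B `^ p)))).
  rewrite ler_pM2l//; apply: lerD; apply: ler_wpM2l.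
  - by rewrite mulr_ge0 ?(ltW q0) ?(ltW T0).
  - by rewrite ler_wpM2l ?exprn_ge0 ?(ltW g0).
  - by rewrite mulr_ge0 ?powR_ge0 ?(ltW q10).
  - by rewrite ler_wpM2l ?sqr_ge0.
have -> : (1 - q) * T `^ (- p) * (Y ^+ 2 * B `^ p) = (1 - q) * s * Y ^+ 2.
  by rewrite -TB; ring.
rewrite mulrDr; apply: lerD.
  have -> : rho * (q * T * (rho ^+ 4 * E)) = q * (rho * rho ^+ 4 * T * E) by ring.
  have -> : rho * rho ^+ 4 * B * s `^ (1 - q^-1) * E = rho * rho ^+ 4 * T * E.
    by rewrite /T; ring.
  (* The factor q < 1 from Young's inequality is dropped here. *)
  apply: ler_piMl; last exact: ltW.
  have g40 : 0 < rho ^+ 4 by exact: exprn_gt0.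
  by apply: mulr_ge0 => //; apply: mulr_ge0; [apply: mulr_ge0|]; exact: ltW.
have -> : rho * ((1 - q) * s * Y ^+ 2) = rho * (1 - q) * (s * Y ^+ 2) by ring.
apply: ler_piMl; first by rewrite mulr_ge0 ?sqr_ge0 ?(ltW s0).
(* From rho <= 2 and 1 - q <= 1/2, the coefficient of s Y^2 is at most 1. *)
have q2 : 1 <= q * 2 by rewrite -ler_pdivrMr// mul1r.
have : rho * (1 - q) <= 2 * (1 - q) by rewrite ler_pM2r.
by lra.
Qed.

End OneSided.

(** * Medians and essential suprema *)

Section Median.
Context d (T : measurableType d) (R : realType) (P : probability T R).
Implicit Types (f : T -> R) (m t c k : R).

Lemma measurable_lt_set f t : measurable_fun setT f -> measurable [set x | f x < t].
Proof.
move=> mf; rewrite (_ : [set _ | _] = setT `&` f @^-1` `]-oo, t[%classic).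
  exact: mf.
by apply/seteqP; split => x /=; rewrite in_itv//= => -[].
Qed.

Lemma measurable_ge_set f t : measurable_fun setT f -> measurable [set x | t <= f x].
Proof.
move=> mf; rewrite (_ : [set _ | _] = ~` [set x | f x < t]).
  exact/measurableC/measurable_lt_set.
by apply/seteqP; split => x /=; [rewrite leNgt => /negP|rewrite leNgt => /negP].
Qed.

Lemma measurable_gt_set f t : measurable_fun setT f -> measurable [set x | t < f x].
Proof.
move=> mf; rewrite (_ : [set _ | _] = [set x | - f x < - t]).
  by apply: (@measurable_lt_set (fun x => - f x)); exact: measurableT_comp.
by apply/seteqP; split => x /=; rewrite ltrN2.
Qed.

(** Continuity from below along the sets where [f] is less than [m - 1/(i+1)]. *)
Lemma probability_lt_le f m c : measurable_fun setT f ->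
  (forall e, 0 < e -> (P [set x | (f x < m - e)%R] <= c%:E)%E) ->
  (P [set x | (f x < m)%R] <= c%:E)%E.
Proof.
move=> mf Pc; pose F (n : nat) := [set x | f x < m - n.+1%:R^-1].
have UF : \bigcup_n F n = [set x | f x < m].
  apply/seteqP; split => [x [i _ /=]|x /= fm].
    by move/lt_le_trans; apply; rewrite gerBl.
  have mf0 : 0 < m - f x by rewrite subr_gt0.
  have [i _ /(_ i (leqnn i))/= h] := @near_infty_natSinv_lt R (PosNum mf0).
  exists i => //.
  by rewrite /F/= ltrBrDr addrC -ltrBrDr.
rewrite -UF.
have cvgF : (P \o F) @ \oo --> P (\bigcup_n F n).
  apply: nondecreasing_cvg_mu => //.
  - by move=> i; exact: measurable_lt_set.
  - by rewrite UF; exact: measurable_lt_set.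
  - move=> i j ij; apply/subsetPset => x /= /lt_le_trans; apply.
    by rewrite lerB// lef_pV2 ?posrE// ler_nat.
rewrite -(cvg_lim _ cvgF)//; apply: lime_le; first by apply/cvg_ex; eexists; exact: cvgF.
by apply: nearW => i; apply: Pc.
Qed.

(** The median is the supremum of the set [S] of all [t] such that [f < t] has mass at most 1/2.
    Below the supremum this mass bound passes to the limit. Above it, [f < t] has mass more than
    1/2, so [t <= f] has mass at most 1/2, and the limit argument is applied to [- f]. *)
Lemma median_exists f k : measurable_fun setT f -> (forall x, `|f x| <= k) ->
  exists m, (P [set x | (f x < m)%R] <= 2^-1%:E)%E /\
            (P [set x | (m < f x)%R] <= 2^-1%:E)%E.
Proof.
move=> mf fk; pose S := [set t | (P [set x | (f x < t)%R] <= 2^-1%:E)%E].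
have Sk : S (- k).
  rewrite /S/= (_ : [set _ | _] = set0) ?measure0 ?lee_fin//.
  apply/seteqP; split => // x /=; have := fk x; rewrite ler_norml => /andP[kf _].
  by rewrite ltNge kf.
have kS t : S t -> t <= k + 1.
  apply: contraPP => /negP; rewrite -ltNge => kt; apply/negP; rewrite -ltNge.
  rewrite (_ : [set _ | _] = setT).
    by rewrite probability_setT lte_fin; lra.
  by apply/seteqP; split => // x _ /=; have := fk x; rewrite ler_norml => /andP[_]; lra.
have supS : has_sup S by split; [exists (- k)|exists (k + 1)].
have S_down t t' : S t -> t' <= t -> S t'.
  move=> St tt; apply: le_trans St; apply: le_measure.
  - exact/mem_set/measurable_lt_set.
  - exact/mem_set/measurable_lt_set.
  - by move=> x /= /lt_le_trans; apply.
exists (sup S); split.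
  apply: probability_lt_le => // e e0.
  have [t St] := sup_adherent e0 supS; move=> /ltW; exact: S_down.
rewrite (_ : [set _ | _] = [set x | (- f x < - sup S)%R]); last first.
  by apply/seteqP; split => x /=; rewrite ltrN2.
apply: probability_lt_le => [|e e0]; first exact: measurableT_comp.
have notS : ~ S (sup S + e).
  by move=> Se; have := sup_upper_bound supS Se; rewrite gerDl leNgt e0.
have Pge : (P [set x | (sup S + e <= f x)%R] <= 2^-1%:E)%E.
  rewrite (_ : [set _ | _] = ~` [set x | f x < sup S + e]); last first.
    by apply/seteqP; split => x /=; [rewrite leNgt => /negP|rewrite leNgt => /negP].
  rewrite probability_setC; last exact: measurable_lt_set.
  move/negP: notS; rewrite -ltNge.
  have /fineK <- : P [set x | (f x < sup S + e)%R] \is a fin_num.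
    by apply: fin_num_measure; exact: measurable_lt_set.
  by rewrite -EFinB lte_fin lee_fin; lra.
apply: le_trans Pge; apply: le_measure.
- apply: mem_set; apply: (@measurable_lt_set (fun x => - f x)); exact: measurableT_comp.
- exact/mem_set/measurable_ge_set.
- by move=> x /=; lra.
Qed.

Lemma ess_sup_ge_level f t : measurable_fun setT f ->
  P [set x | t <= f x] != 0%E -> (t%:E <= ess_sup P (fun x => (f x)%:E))%E.
Proof.
move=> mf; apply: contra_neqT; rewrite -ltNge => St.
have [N [mN PN NS]] := ess_sup_ge P (fun x => (f x)%:E).
apply: (subset_measure0 (measurable_ge_set t mf) mN _ PN) => x /= tf.
apply: NS => /= /le_lt_trans /(_ St); rewrite lte_fin ltNge.
by rewrite tf.
Qed.

Lemma ess_sup_fin_num f k : (forall x, `|f x| <= k) ->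
  ess_sup P (fun x => (f x)%:E) \is a fin_num.
Proof.
move=> fk; have P0 : (0 < P setT)%E by rewrite probability_setT lte_fin.
rewrite fin_numElt; apply/andP; split.
  apply: (@lt_le_trans _ _ (- k)%:E); first exact: ltNyr.
  apply: ess_sup_gee => //; apply: nearW => x; rewrite lee_fin.
  by have := fk x; rewrite ler_norml => /andP[].
apply: (@le_lt_trans _ _ k%:E); last exact: ltry.
apply/ess_supP; apply: nearW => x; rewrite lee_fin.
by have := fk x; rewrite ler_norml => /andP[].
Qed.

End Median.

(** * The weak Poincare inequality *)

Lemma sqrD_superadd (R : realDomainType) (x y : R) : 0 <= x -> 0 <= y ->
  x ^+ 2 + y ^+ 2 <= (x + y) ^+ 2.
Proof.
by move=> x0 y0; rewrite [leRHS]sqrrD lerD2r lerDl mulrn_wge0// mulr_ge0.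
Qed.

Section WeakPoincare.
Context (R : realType) (n : nat) (M : ptopologicalType).
Variable X : riemannian_manifold R n M.
Variable mu : probability (borel M) R.
Variable nu : {measure set (borel M) -> \bar R}.
Variable q : R.
Hypotheses (q_ge : 2^-1 <= q) (q_lt1 : q < 1).

Let q_gt0 : 0 < q.
Proof. by apply: lt_le_trans q_ge. Qed.

Let p_gt0 : 0 < q / (1 - q).
Proof. by rewrite divr_gt0 ?subr_gt0. Qed.

Lemma beta_P_ge0 : (0 <= beta_P X mu nu q)%E.
Proof. exact: poweR_ge0. Qed.

Lemma beta_P_lty C : Lq_poincare X mu nu q C -> (beta_P X mu nu q < +oo)%E.
Proof.
move=> LqP; apply: poweR_lty.
apply: (@le_lt_trans _ _ (2 `^ (q / (1 - q)) * (`|C| * 3 `^ q^-1) `^ (q / (1 - q)))%:E);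
  last exact: ltry.
apply: ge_ereal_sup => _ [Om [Omk [mOm Om_half mOmk OmkS ->]]].
apply: (esum_cap_le q_ge q_lt1 LqP mOm Om_half mOmk) => k; first by case: (OmkS k).
by have [S1 S2] := OmkS k; exact: subset_trans S1 S2.
Qed.

(** The exponents (1-q)/q and q/(1-q) are inverse to each other, so the outer power in [beta_P] can
    be undone. A real bound [B] is used instead of [beta_P] because the one-sided estimate needs it
    to be positive. *)
Lemma esum_le_beta_P (B : R) (Om : set (borel M)) (Omk : int -> set (borel M)) :
  (beta_P X mu nu q <= B%:E)%E ->
  measurable Om -> (mu Om <= 2^-1%:E)%E -> (forall k, measurable (Omk k)) ->
  (forall k, Omk k `<=` Omk (k + 1) /\ Omk (k + 1) `<=` Om) ->
  (\esum_(k in [set: int]) (mu (Omk k) `^ (1 - q)^-1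
     / capacity X nu (Omk k) (Omk (k + 1)%R) `^ (q / (1 - q)))
   <= (B `^ (q / (1 - q)))%:E)%E.
Proof.
move=> bB mOm Om_half mOmk OmkS; set S := (\esum_(k in _) _)%E.
have S0 : (0 <= S)%E.
  apply: esum_ge0 => k _; apply: mule_ge0; first exact: poweR_ge0.
  by rewrite inve_ge0 poweR_ge0.
apply: (@le_trans _ _ (beta_P X mu nu q `^ (q / (1 - q)))%E); last first.
  rewrite -poweR_EFin; apply: gt0_ler_poweR; rewrite ?in_itv/= ?leey ?andbT ?beta_P_ge0//.
    exact: ltW.
  by rewrite (le_trans beta_P_ge0 bB).
rewrite /beta_P; set Sup := ereal_sup _.
have SSup : (S <= Sup)%E by apply: ereal_sup_ubound; exists Om, Omk; split.
have qq : (1 - q) / q * (q / (1 - q)) = 1.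
  by rewrite -[q / _]invf_div mulfV// mulf_neq0 ?invr_neq0 ?gt_eqF ?subr_gt0.
by rewrite -poweRrM qq poweRe1// (le_trans S0 SSup).
Qed.

Lemma kappa_ge0 : 0 <= kappa R.
Proof. by rewrite divr_ge0// addr_ge0// mulr_ge0// sqrtr_ge0. Qed.

Lemma osc_fin_num (f : M -> R) (k : R) : (forall x, `|f x| <= k) ->
  osc mu f \is a fin_num.
Proof.
move=> fk; rewrite /osc ess_infEN oppeK fin_numD.
rewrite (@ess_sup_fin_num _ (borel M) _ mu f k fk).
apply: (@ess_sup_fin_num _ (borel M) _ mu (fun x => - f x) k) => x.
by rewrite normrN.
Qed.

(** The variance is at most the second moment about a median [m], which splits into the parts above
    and below [m]. Their energies live on disjoint sets and add up to at most [E]; their heights add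
    up to the oscillation. *)
Lemma variance_le_bounded f (k B E s : R) : C1 X f -> (forall x, `|f x| <= k) ->
  0 < B -> (beta_P X mu nu q <= B%:E)%E -> (energy X nu f <= E%:E)%E -> 0 < s ->
  (variance mu (f : borel M -> R) <=
   (kappa R * B * s `^ (1 - q^-1) * E + s * (fine (osc mu f)) ^+ 2)%:E)%E.
Proof.
move=> Cf fk B0 bB fE s0.
have mf := C1_measurable Cf.
have [m [mlt mgt]] := median_exists mu mf fk.
have ff : ess_sup mu (fun x : borel M => (f x)%:E) \is a fin_num.
  exact: (@ess_sup_fin_num _ (borel M) _ mu f k fk).
have fNk x : `|- f x| <= k by rewrite normrN.
have fN : ess_sup mu (fun x : borel M => (- f x)%:E) \is a fin_num.
  exact: (@ess_sup_fin_num _ (borel M) _ mu (fun x => - f x) k fNk).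
set S := fine (ess_sup mu (fun x : borel M => (f x)%:E)).
(* This is minus the essential infimum of [f], so that the oscillation is [S + I]. *)
set I := fine (ess_sup mu (fun x : borel M => (- f x)%:E)).
have oscE : fine (osc mu f) = S + I.
  by rewrite /osc ess_infEN oppeK fineD.
have mfN : measurable_fun setT (fun x : borel M => - f x) by exact: measurableT_comp.
have S_level t : mu [set x | (t <= f x)%R] != 0%E -> t <= S.
  by move=> /(ess_sup_ge_level mf); rewrite -(fineK ff) lee_fin.
have I_level t : mu [set x | (t <= - f x)%R] != 0%E -> t <= I.
  by move=> /(ess_sup_ge_level mfN); rewrite -(fineK fN) lee_fin.
(* Each of the sets [m <= f] and [f <= m] has mass at least 1/2, hence [m] lies between the
   essential bounds of [f]. *)
have half_neq0 A : measurable A -> (mu (~` A) <= 2^-1%:E)%E -> mu A != 0%E.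
  move=> mA; rewrite probability_setC//; apply: contraTneq => ->.
  by rewrite sube0 -ltNge lte_fin; lra.
have mS : m <= S.
  apply: S_level; apply: half_neq0; first exact: measurable_ge_set.
  by apply: le_trans mlt; rewrite le_eqVlt; apply/orP; left; apply/eqP; congr (mu _);
    apply/seteqP; split => x /=; [move/negP; rewrite -ltNge|rewrite ltNge => /negP].
have mI : - m <= I.
  apply: I_level; apply: half_neq0; first exact: measurable_ge_set.
  by apply: le_trans mgt; rewrite le_eqVlt; apply/orP; left; apply/eqP; congr (mu _);
    apply/seteqP; split => x /=; rewrite lerN2; [move/negP; rewrite -ltNge|rewrite ltNge => /negP].
pose u1 x := f x - m; pose u2 x := m - f x.
have Cu1 : C1 X u1 by apply: (C1D Cf); exact: C1_cst.
have grad1 x : grad X u1 x = grad X f x.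
  by rewrite (gradD x Cf (@C1_cst _ _ _ X (- m))) grad_cst addr0.
have u2E : u2 = (fun x => (-1) * u1 x) by apply/funext => x; rewrite /u2 /u1; ring.
have Cu2 : C1 X u2 by rewrite u2E; exact: C1Z.
have grad2 x : grad X u2 x = (-1) *: grad X f x.
  have dN (t : R) : is_derive t (1 : R) (fun r : R => -1 * r) (-1).
    by apply: is_derive_eq; rewrite /GRing.scale/= mulr1.
  rewrite u2E -[LHS]/(grad X ((fun r => -1 * r) \o u1) x).
  rewrite grad_comp; [|by move=> t; have [] := dN t|exact: Cu1].
  by rewrite derive1E derive_val grad1.
have e1 : energy_on X nu [set x | 0 < u1 x] u1 = energy_on X nu [set x | m < f x] f.
  apply: eq_energy_on => [|x]; last exact: eq_sqnorm_grad.
  by apply/seteqP; split => x; rewrite /u1/= subr_gt0.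
have e2 : energy_on X nu [set x | 0 < u2 x] u2 = energy_on X nu [set x | f x < m] f.
  apply: eq_energy_on => [|x].
    by apply/seteqP; split => x; rewrite /u2/= subr_gt0.
  by rewrite (sqnorm_gradZ (grad2 x)) sqrrN expr1n mul1r.
have e12 : (energy_on X nu [set x | (m < f x)%R] f +
    energy_on X nu [set x | (f x < m)%R] f <= E%:E)%E.
  apply: le_trans fE; apply: energy_on_disjoint_le.
  - exact: measurable_gt_set.
  - exact: measurable_lt_set.
  - by apply/disj_setPS => x /= [] /lt_trans /[apply]; rewrite ltxx.
have fin_energy A g : (energy_on X nu A g <= E%:E)%E ->
    energy_on X nu A g = (fine (energy_on X nu A g))%:E.
  move=> gE; symmetry; apply: fineK; rewrite ge0_fin_numE; last exact: energy_on_ge0.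
  exact: le_lt_trans gE (ltry E).
have [E1 E1fin] : exists r, energy_on X nu [set x | 0 < u1 x] u1 = r%:E.
  eexists; apply: fin_energy; rewrite e1; apply: le_trans e12.
  by apply: leeDl; exact: energy_on_ge0.
have [E2 E2fin] : exists r, energy_on X nu [set x | 0 < u2 x] u2 = r%:E.
  eexists; apply: fin_energy; rewrite e2; apply: le_trans e12.
  by apply: leeDr; exact: energy_on_ge0.
have E12 : E1 + E2 <= E.
  by rewrite -lee_fin EFinD; move: e12; rewrite -e1 -e2 E1fin E2fin.
have bnd (Om : set (borel M)) (Omk : int -> set (borel M)) := @esum_le_beta_P B Om Omk bB.
have I1 : (\int[mu]_x (pos_part (u1 x) ^+ 2)%:E <=
     (kappa R * B * s `^ (1 - q^-1) * E1 + s * (S - m) ^+ 2)%:E)%E.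
  apply: (@integral_sqr_pos_part_le _ _ _ X mu nu q B q_ge q_lt1 B0 bnd u1 (k - m) _ _ _ Cu1).
  - by move=> x; rewrite lerD2r (le_trans (ler_norm _)).
  - apply: le_trans mgt; rewrite le_eqVlt; apply/orP; left; apply/eqP; congr (mu _).
    by apply/seteqP; split => x; rewrite /u1/= subr_gt0.
  - by rewrite subr_ge0.
  - move=> t _; rewrite lerBrDr => ht; apply: S_level; apply: contra_neq ht => <-.
    by congr (mu _); apply/seteqP; split => x; rewrite /u1/= lerBrDr.
  - by rewrite E1fin.
  - exact: s0.
have I2 : (\int[mu]_x (pos_part (u2 x) ^+ 2)%:E <=
     (kappa R * B * s `^ (1 - q^-1) * E2 + s * (I + m) ^+ 2)%:E)%E.
  apply: (@integral_sqr_pos_part_le _ _ _ X mu nu q B q_ge q_lt1 B0 bnd u2 (k + m) _ _ _ Cu2).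
  - by move=> x; rewrite /u2 addrC lerD2r (le_trans (ler_norm _)).
  - apply: le_trans mlt; rewrite le_eqVlt; apply/orP; left; apply/eqP; congr (mu _).
    by apply/seteqP; split => x; rewrite /u2/= subr_gt0.
  - by rewrite -lerBlDr sub0r.
  - move=> t _ ht; rewrite -lerBlDr; apply: I_level; apply: contra_neq ht => <-.
    by congr (mu _); apply/seteqP; split => x; rewrite /u2/= lerBlDr addrC.
  - by rewrite E2fin.
  - exact: s0.
apply: le_trans (variance_bounded_le mu m mf fk) _.
have -> : (\int[mu]_x ((f x - m) ^+ 2)%:E = \int[mu]_x (pos_part (u1 x) ^+ 2)%:E
   + \int[mu]_x (pos_part (u2 x) ^+ 2)%:E)%E.
  have mpos u : C1 X u -> measurable_fun [set: borel M] (fun x => (pos_part (u x) ^+ 2)%:E).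
    move=> Cu; apply/measurable_EFinP/measurable_funX.
    apply: (measurableT_comp _ (C1_measurable Cu)).
    by apply: measurable_maxr => //.
  have p0 (u : M -> R) (x : borel M) : [set: borel M] x -> (0 <= (pos_part (u x) ^+ 2)%:E)%E.
    by move=> _; rewrite lee_fin sqr_ge0.
  rewrite -(ge0_integralD mu measurableT (p0 u1) (mpos u1 Cu1) (p0 u2) (mpos u2 Cu2)).
  apply: eq_integral => x _; rewrite -EFinD; congr EFin.
  by rewrite /u1 /u2 -sqr_pos_part_split opprB.
apply: le_trans (leeD I1 I2) _; rewrite -EFinD lee_fin oscE.
have K0 : 0 <= kappa R * B * s `^ (1 - q^-1).
  apply: mulr_ge0; last exact: powR_ge0.
  by apply: mulr_ge0; [exact: kappa_ge0|exact: ltW].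
rewrite addrACA -!mulrDr; apply: lerD; first exact: ler_wpM2l.
have Sm0 : 0 <= S - m by rewrite subr_ge0.
have Im0 : 0 <= I + m by rewrite -lerBlDr sub0r.
apply: ler_wpM2l; first exact: ltW.
(* The squared heights [S - m] and [I + m] of the two parts sum to at most the square of their
   sum. *)
have -> : S + I = (S - m) + (I + m) by ring.
exact: sqrD_superadd.
Qed.

End WeakPoincare.

(** * From positive upper bounds to [beta_P] itself *)

Unset Implicit Arguments.
Set Strict Implicit.

Theorem proposition3p2 (R : realType) (n : nat) (M : ptopologicalType)
    (X : riemannian_manifold R n M) (mu : probability (borel M) R)
    (nu : {measure set (borel M) -> \bar R}) (q : R) :
  2^-1 <= q < 1 ->
  (exists C : R, Lq_poincare X mu nu q C) ->
  weak_poincare X mu nu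
    (fun s => ((kappa R)%:E * beta_P X mu nu q * (s `^ (1 - q^-1))%:E)%E).
Proof.
move=> /andP[q_ge q_lt1] [C LqP].
have q_gt0 : 0 < q by apply: lt_le_trans q_ge.
have bE : beta_P X mu nu q = (fine (beta_P X mu nu q))%:E.
  by rewrite fineK// ge0_fin_numE ?beta_P_ge0// (beta_P_lty q_ge q_lt1 LqP).
move: bE (beta_P_ge0 X mu nu q); set b := fine _ => bE.
rewrite bE lee_fin => b0; have kb0 : 0 <= kappa R * b by rewrite mulr_ge0// kappa_ge0.
split.
- move=> s s0; rewrite -!EFinM lee_fin ltry andbT.
  by rewrite mulr_ge0// powR_ge0.
- move=> s t s0 st; rewrite -!EFinM lee_fin ler_wpM2l//.
  (* The exponent of [s] is non-positive, so the function is non-increasing. *)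
  have rr : 0 <= q^-1 - 1 by rewrite subr_ge0 invf_ge1// ltW.
  rewrite -opprB !powRN lef_pV2 ?posrE ?powR_gt0 ?(lt_le_trans s0 st)//.
  by rewrite ge0_ler_powR ?nnegrE ?(ltW s0) ?(ltW (lt_le_trans s0 st)).
move=> f Cf [k0 [_ fk0]] s s0.
have fk x : `|f x| <= `|k0| + 1.
  by apply: fk0 => //; rewrite (le_lt_trans (ler_norm _))// ltrDl.
(* With infinite energy the right side is infinite, as the oscillation term is non-negative. *)
rewrite /mul_energy; case: ifPn => [_|Efin].
  rewrite addye ?leey// gt_eqF// (lt_le_trans (ltNyr 0))//.
  by rewrite mule_ge0 ?sqre_ge0// lee_fin ltW.
have Efin' : energy X nu f \is a fin_num by rewrite ge0_fin_numE ?energy_ge0// ltey.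
have oE : osc mu f = (fine (osc mu f))%:E.
  by rewrite fineK//; exact: osc_fin_num fk.
rewrite -(fineK Efin') oE -EFin_expe -!EFinM -EFinD.
set E := fine (energy _ _ _); set o := fine _.
have A0 : 0 <= kappa R * s `^ (1 - q^-1) * E.
  by rewrite mulr_ge0 ?mulr_ge0 ?powR_ge0 ?kappa_ge0 ?fine_ge0 ?energy_ge0.
apply/lee_addgt0Pr => eps eps0.
(* Since [b] may be zero, the estimate is applied with [b + d]; this [d] makes the extra energy term
   at most [eps]. The added 1 keeps the denominator positive. *)
pose d := eps / (kappa R * s `^ (1 - q^-1) * E + 1).
have d0 : 0 < d by rewrite divr_gt0// ltr_wpDl.
have bd : (beta_P X mu nu q <= (b + d)%:E)%E by rewrite bE lee_fin lerDl ltW.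
have bd0 : 0 < b + d by rewrite ltr_wpDl.
apply: le_trans (variance_le_bounded q_ge q_lt1 Cf fk bd0 bd _ s0 (E := E)) _.
  by rewrite /E fineK.
rewrite -EFinD lee_fin -/o.
have -> : kappa R * (b + d) * s `^ (1 - q^-1) * E =
  kappa R * b * s `^ (1 - q^-1) * E + d * (kappa R * s `^ (1 - q^-1) * E) by ring.
have : d * (kappa R * s `^ (1 - q^-1) * E) <= eps.
  by rewrite /d mulrAC ler_pdivrMr ?ltr_wpDl// ler_pM2l// lerDl.
lra.
Qed.
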